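(* Let $X$ be a finite tripartite triangle complex on $n$ vertices in which every vertex has degree $k_0$ and every edge lies in exactly $k_1$ triangles, and suppose that \[ \mathrm{Spec}\,\Delta_0^+|_{Z_0}\subseteq[k_0-\mu_0,k_0+\mu_0]\cup\{\tfrac{3k_0}{2}\},\qquad \mathrm{Spec}\,\Delta_1^+|_{Z_1}\subseteq[k_1-\mu_1,k_1+\mu_1]\cup[2k_1-\mu_1,2k_1+\mu_1]\cup\{3k_1\}. \] Let $A,B,C,D$ be pairwise disjoint sets of vertices of sizes $a,b,c,d$ such that each of $A\cup D$, $B$ and $C$ is contained in a different block of the three-partition of $X$. Then \[ \left|\,|F^2(A,B,C,D)|-\frac{27k_0k_1^2abcd}{2n^3}\right|\leq\frac{6\mu_0k_1^2\sqrt{abcd}}{k_0n}\left(\frac{3k_0(\sqrt{ab}+\sqrt{cd})}{2n}+\mu_0\right)+\left[\frac{2k_1^2\mu_0}{k_0}+(k_1+\mu_1)\mu_1\right]\sqrt[4]{abcd}\,\sqrt{\left(\tfrac{3k_0\sqrt{ab}}{2n}+\mu_0\right)\left(\tfrac{3k_0\sqrt{cd}}{2n}+\mu_0\right)}. \]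
   Context: A triangle complex is a simplicial complex of dimension $2$; it is tripartite if its vertex set can be partitioned into three blocks such that every triangle has one vertex in each block. Simplicial notation: $\Omega^i$ = skew-symmetric complex functions on oriented $i$-cells with $\langle f,g\rangle=\sum_{\sigma\in X^i}f(\sigma)\overline{g(\sigma)}$, $\Omega^{-1}=\mathbb{C}$; $(\partial_if)(\sigma)=\sum_{v:v\sigma\in X^i}f(v\sigma)$ (so $\partial_0f=\sum_vf(v)$), $\delta_i=\partial_i^*$; $\Delta_i^+=\partial_{i+1}\delta_{i+1}$ ($\Delta_0^+$ is the graph Laplacian); $Z_i=\ker\partial_i$. $F^2(A,B,C,D)$ is the set of ordered pairs $(t,t')$ of triangles with $t$ having one vertex in each of $A,B,C$, $t'$ having one vertex in each of $B,C,D$, and $t\cap t'$ an edge. *)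

(* Defs.v *)
From HB Require Import structures.
From mathcomp Require Import all_boot all_order all_algebra.
From mathcomp Require Import fingroup perm complex.
Set Implicit Arguments. Unset Strict Implicit. Unset Printing Implicit Defensive.
Import Order.TTheory GRing.Theory Num.Theory.
Local Open Scope ring_scope.

Section Complexes.
Variable V : finType.

Definition triangle_complex (X : {set {set V}}) : Prop :=
  [/\ forall s : {set V}, s \in X -> s != set0,
      forall s t : {set V}, s \in X -> t \subset s -> t != set0 -> t \in X,
      forall s : {set V}, s \in X -> (#|s| <= 3)%N,
      forall v : V, [set v] \in X
    & exists t, (t \in X) && (#|t| == 3)].

Definition edges (X : {set {set V}}) := [set e in X | #|e| == 2].
Definition triangles (X : {set {set V}}) := [set t in X | #|t| == 3].

Definition tripartition (X : {set {set V}}) (part : V -> 'I_3) : Prop :=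
  forall t, t \in triangles X -> forall i : 'I_3, #|[set x in t | part x == i]| = 1.

Definition vertex_degree (X : {set {set V}}) (v : V) : nat :=
  #|[set e in edges X | v \in e]|.

Definition edge_degree (X : {set {set V}}) (e : {set V}) : nat :=
  #|[set t in triangles X | e \subset t]|.

Variable R : rcfType.
Local Notation C := R[i].

Definition oriented_cell (X : {set {set V}}) k (t : k.-tuple V) : bool :=
  uniq t && ([set x in t] \in X).

Definition cochain (i : nat) := (i.+1).-tuple V -> C.

Definition permute_tuple k (s : 'S_k) (t : k.-tuple V) : k.-tuple V :=
  [tuple tnth t (s j) | j < k].

Definition in_Omega (X : {set {set V}}) i (f : cochain i) : Prop :=
  (forall (s : 'S_(i.+1)) t, f (permute_tuple s t) = (-1) ^+ odd_perm s * f t)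
  /\ (forall t, ~~ oriented_cell X t -> f t = 0).

(* <f,g> = sum over i-cells (one orientation each) of f(s) conj(g(s));
   written as the sum over all orientations divided by (i+1)!  *)
Definition inner (X : {set {set V}}) i (f g : cochain i) : C :=
  ((i.+1)`!%:R)^-1 * \sum_(t in [pred t : (i.+1).-tuple V | oriented_cell X t]) f t * (g t)^*.

Definition bd0 (X : {set {set V}}) (f : cochain 0) : C :=
  \sum_(v : V | oriented_cell X [tuple v]) f [tuple v].

Definition bd (X : {set {set V}}) i (f : cochain i.+1) : cochain i :=
  fun s => \sum_(v : V | oriented_cell X [tuple of v :: s]) f [tuple of v :: s].

Definition is_coboundary (X : {set {set V}}) i (d : cochain i -> cochain i.+1) : Prop :=
  (forall g, in_Omega X g -> in_Omega X (d g)) /\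
  (forall f g, in_Omega X f -> in_Omega X g -> inner X (bd X f) g = inner X f (d g)).

(* lambda is in Spec (Delta_0^+ restricted to Z_0), Delta_0^+ = partial_1 delta_1 *)
Definition spec_up0 (X : {set {set V}}) (d1 : cochain 0 -> cochain 1) (lam : C) : Prop :=
  exists f : cochain 0, [/\ in_Omega X f, bd0 X f = 0, exists t, f t != 0
                          & forall t, bd X (d1 f) t = lam * f t].

(* lambda is in Spec (Delta_1^+ restricted to Z_1), Delta_1^+ = partial_2 delta_2 *)
Definition spec_up1 (X : {set {set V}}) (d2 : cochain 1 -> cochain 2) (lam : C) : Prop :=
  exists f : cochain 1, [/\ in_Omega X f, (forall t, bd X f t = 0), exists t, f t != 0
                          & forall t, bd X (d2 f) t = lam * f t].

Definition in_interval (x lo hi : R) := lo <= x <= hi.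

Definition F2 (X : {set {set V}}) (A B C' D : {set V}) : {set {set V} * {set V}} :=
  [set p : {set V} * {set V} |
     [&& p.1 \in triangles X, p.2 \in triangles X,
         #|p.1 :&: A| == 1, #|p.1 :&: B| == 1, #|p.1 :&: C'| == 1,
         #|p.2 :&: B| == 1, #|p.2 :&: C'| == 1, #|p.2 :&: D| == 1
       & #|p.1 :&: p.2| == 2]].

End Complexes.

(* Main.v *)
Require Import Defs.
From HB Require Import structures.
From mathcomp Require Import all_boot all_order all_algebra.
From mathcomp Require Import fingroup perm complex ring lra.
Import Order.TTheory GRing.Theory Num.Theory.
Local Open Scope ring_scope.

(** Write [f] and [g] for the skew indicator functions of the edges from [A] to [B] and
    from [C] to [D], and let [T1 = k1 - Delta_1^+]. Pairs of triangles are counted by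
    [<T1 f, T1 g>], while [<T1 f, g> = 0]; hence [|F^2| = <P f, g>] for
    [P = T1 (T1 + k1)]. On [Z_1] the spectral hypothesis makes [|P| <= (k1 + mu1) mu1],
    except on the eigenspace of [3 k1], where [P = 2 k1^2], its value on coboundaries.
    The coboundary part of [f] is [delta phi] with [Delta_0^+ phi = partial f]; splitting
    [phi] into its component constant on blocks (eigenvalue [3 k0 / 2]) and a rest on which
    [Delta_0^+] is within [mu0] of [k0], and using [<partial f, partial g> = 0], one finds
    the main term [6 k1^2 |E(A,B)| |E(C,D)| / (n k0)], and the expander mixing lemma
    evaluates the edge counts.

    This needs the eigenspaces of [3 k0 / 2] and [3 k1] to be the obvious ones, which the
    hypotheses do not say. If [mu0 < k0] and [mu1 < k1], the graph is connected and the first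
    cohomology vanishes; then the triangles are connected through edges: a set [S] of edges
    closed under triangles cuts [delta 1_v] down to a closed form, hence to some [delta phi],
    and double counting the edges inside a level set of [phi] shows that [S] contains all or
    none of the edges at [v]. Otherwise the right hand side is at least [2 k1^2] times the
    last square roots, and the crude estimate [|F^2| <= k1^2 sqrt (|E(A,B)| |E(C,D)|)] is
    enough, because a non-obvious eigenfunction for [3 k0 / 2] forces [mu0 >= k0 / 4]. *)

Set Implicit Arguments.
Unset Strict Implicit.
Unset Printing Implicit Defensive.

(** * Symmetric kernels on finite sets *)

Section Spectral.
Variable R : rcfType.

(** Over the complex numbers [M] is Hermitian, hence unitarily diagonalizable with real eigenvalues,
    and [s] lists these without repetition. The fold applies the product of all [M - x], whose
    factor at [x = r j] kills the [j]-th coordinate in the eigenbasis. *)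
Lemma symmetric_mx_annihilator m (M : 'M[R]_m) : M^T = M ->
  exists2 s : seq R, uniq s &
    forall u : 'cV_m, foldl (fun v x => M *m v - x *: v) u s = 0.
Proof.
move=> Msym; pose toC := real_complex R; pose MC := map_mx toC M.
have MCherm : MC \is hermsymmx.
  apply: realsym_hermsym.
    apply/is_hermitianmxP; rewrite expr0 scale1r.
    by apply/matrixP => i j; rewrite !mxE -{1}Msym mxE.
  by apply/mxOverP => i j; rewrite mxE; apply/complex_realP; exists (M i j).
have MCdiag := orthomx_spectralP (hermitian_normalmx MCherm).
have dreal := hermitian_spectral_diag_real MCherm.
set P := spectralmx MC in MCdiag; set d := spectral_diag MC in MCdiag dreal.
have Pu : P \in unitmx := spectral_unit MC.
have [r dr] : exists r : 'I_m -> R, forall j, d 0 j = toC (r j).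
  exists (fun j => complex.Re (d 0 j)) => j.
  by rewrite /toC RRe_real //; move/mxOverP: dreal; apply.
exists (undup [seq r j | j <- enum 'I_m]); first exact: undup_uniq.
set s := undup _ => u.
have step v x : P *m map_mx toC (M *m v - x *: v)
    = diag_mx d *m (P *m map_mx toC v) - toC x *: (P *m map_mx toC v).
  rewrite map_mxB map_mxM map_mxZ -/MC [in LHS]MCdiag mulmxBr -scalemxAr.
  by rewrite -!mulmxA mulKVmx.
have iterE l v j : (P *m map_mx toC (foldl (fun v x => M *m v - x *: v) v l)) j 0
    = (\prod_(x <- l) (toC (r j) - toC x)) * (P *m map_mx toC v) j 0.
  elim: l v => [|x l IH] v /=; first by rewrite big_nil mul1r.
  rewrite IH step big_cons mul_diag_mx !mxE dr; ring.
have uC0 : P *m map_mx toC (foldl (fun v x => M *m v - x *: v) u s) = 0.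
  apply/matrixP => j k; rewrite ord1 iterE [RHS]mxE.
  have rs : r j \in s by rewrite mem_undup map_f ?mem_enum.
  by rewrite (big_rem _ rs) /= subrr !mul0r.
have : map_mx toC (foldl (fun v x => M *m v - x *: v) u s) = 0.
  by rewrite -[LHS](mulKmx Pu) uC0 mulmx0.
by rewrite -(map_mx0 toC) => /map_mx_inj.
Qed.

Section Kernel.
Variable I : finType.
Local Notation F := {ffun I -> R^o}.
Implicit Types (f g u v : F) (K : I -> I -> R) (c : R).

Definition ip f g : R := \sum_i f i * g i.
Definition opK K f : F := [ffun i => \sum_j K i j * f j].

Lemma ffZE c f i : (c *: f) i = c * f i.
Proof. by rewrite ffunE. Qed.

Lemma ffBE f g i : (f - g) i = f i - g i.
Proof. by rewrite !ffunE. Qed.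

Lemma ipC f g : ip f g = ip g f.
Proof. by apply: eq_bigr => i _; rewrite mulrC. Qed.

Lemma ip_linear f : linear (ip f : F -> R^o).
Proof.
move=> c g h; rewrite /ip scaler_sumr -big_split; apply: eq_bigr => i _ /=.
by rewrite !ffunE /GRing.scale /=; ring.
Qed.
HB.instance Definition _ f :=
  GRing.isLinear.Build R F R^o _ (ip f) (ip_linear f).

Lemma ipDr f g h : ip f (g + h) = ip f g + ip f h.
Proof. exact: linearD. Qed.
Lemma ipBr f g h : ip f (g - h) = ip f g - ip f h.
Proof. exact: linearB. Qed.
Lemma ipZr f c g : ip f (c *: g) = c * ip f g.
Proof. exact: linearZ. Qed.
Lemma ip0r f : ip f 0 = 0.
Proof. exact: linear0. Qed.
Lemma ipDl f g h : ip (g + h) f = ip g f + ip h f.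
Proof. by rewrite !(ipC _ f) ipDr. Qed.
Lemma ipBl f g h : ip (g - h) f = ip g f - ip h f.
Proof. by rewrite !(ipC _ f) ipBr. Qed.
Lemma ipZl f c g : ip (c *: g) f = c * ip g f.
Proof. by rewrite !(ipC _ f) ipZr. Qed.

Lemma ip_ge0 f : 0 <= ip f f.
Proof. by apply: sumr_ge0 => i _; rewrite -expr2 sqr_ge0. Qed.

Lemma ip_eq0 f : ip f f = 0 -> f = 0.
Proof.
move=> /eqP; rewrite psumr_eq0 => [/allP f0|i _]; last by rewrite -expr2 sqr_ge0.
apply/ffunP => i; rewrite ffunE.
by have /implyP/(_ isT) := f0 i (mem_index_enum _); rewrite mulf_eq0 orbb => /eqP.
Qed.

Lemma cauchy_schwarz f g : `|ip f g| <= Num.sqrt (ip f f) * Num.sqrt (ip g g).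
Proof.
rewrite -sqrtrM ?ip_ge0 // -sqrtr_sqr ler_wsqrtr //.
have [f0|fN0] := eqVneq (ip f f) 0.
  by rewrite (ip_eq0 f0) !(ipC 0) !ip0r expr0n mul0r.
have fgt0 : 0 < ip f f by rewrite lt_neqAle eq_sym fN0 ip_ge0.
have := ip_ge0 (ip f f *: g - ip f g *: f).
rewrite !(ipBl, ipBr, ipZl, ipZr) (ipC g f) => h.
suff : 0 <= ip f f * (ip f f * ip g g - ip f g ^+ 2).
  by rewrite pmulr_rge0 // subr_ge0.
by apply: le_trans h _; rewrite le_eqVlt; apply/orP; left; apply/eqP; ring.
Qed.

Lemma opK_linear K : linear (opK K).
Proof.
move=> c f g; apply/ffunP => i; rewrite !ffunE /GRing.scale /= mulr_sumr -big_split.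
by apply: eq_bigr => j _ /=; rewrite !ffunE /GRing.scale /=; ring.
Qed.
HB.instance Definition _ K :=
  GRing.isLinear.Build R F F _ (opK K) (opK_linear K).

Lemma ip_opK K f g : (forall i j, K i j = K j i) -> ip (opK K f) g = ip f (opK K g).
Proof.
move=> Ksym; rewrite /ip.
transitivity (\sum_i \sum_j f j * (K j i * g i)).
  apply: eq_bigr => i _; rewrite ffunE mulr_suml; apply: eq_bigr => j _.
  by rewrite Ksym; ring.
by rewrite exchange_big; apply: eq_bigr => j _; rewrite ffunE mulr_sumr.
Qed.

Lemma symmetric_annihilator K : (forall i j, K i j = K j i) ->
  exists2 s : seq R, uniq s &
    forall u, foldl (fun v x => opK K v - x *: v) u s = 0.
Proof.
move=> Ksym.
pose M := \matrix_(i, j < #|I|) K (enum_val i) (enum_val j).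
have [|s us Ms] := @symmetric_mx_annihilator _ M.
  by apply/matrixP => i j; rewrite !mxE.
exists s => // u.
pose col (f : F) : 'cV[R]_#|I| := \col_i f (enum_val i).
have colT f : col (opK K f) = M *m col f.
  apply/matrixP => i j; rewrite !mxE ffunE (reindex _ (onW_bij _ (@enum_val_bij I))) /=.
  by apply: eq_bigr => k _; rewrite !mxE.
have colE l f : col (foldl (fun v x => opK K v - x *: v) f l)
    = foldl (fun (w : 'cV_#|I|) x => M *m w - x *: w) (col f) l.
  elim: l f => //= x l IH f; rewrite IH -colT; congr (foldl _ _ l).
  by apply/matrixP => i j; rewrite !mxE !ffunE.
apply/ffunP => i; have /matrixP/(_ (enum_rank i) 0) := Ms (col u).
by rewrite -colE !mxE enum_rankK ffunE.
Qed.

Definition subspace (W : F -> Prop) :=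
  W 0 /\ forall c f g, W f -> W g -> W (c *: f + g).

Section Invariant.
Variables (K : I -> I -> R) (W : F -> Prop).
Hypotheses (Ksym : forall i j, K i j = K j i) (Wsub : subspace W)
  (WK : forall f, W f -> W (opK K f)).

Lemma subspaceZ c f : W f -> W (c *: f).
Proof. by case: Wsub => W0 Wl Wf; rewrite -[_ *: _]addr0; apply: Wl. Qed.

Lemma subspaceB f g : W f -> W g -> W (f - g).
Proof. by case: Wsub => W0 Wl Wf Wg; rewrite addrC -scaleN1r; apply: Wl. Qed.

Lemma subspace_sum (J : eqType) (s : seq J) (E : J -> F) :
  (forall x, x \in s -> W (E x)) -> W (\sum_(x <- s) E x).
Proof.
case: Wsub => W0 Wl WE; rewrite big_seq; elim/big_ind: _ => // f g Wf Wg.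
by rewrite -[f]scale1r; apply: Wl.
Qed.

(** Induction on the annihilating list: [(K - x) u] is killed by the remaining factors, so it is a
    sum of eigenvectors [E' y]. Divide these by [y - x], which is nonzero as the list has no
    repetition; subtracting the result from [u] leaves a vector killed by [K - x]. All of this stays
    inside the invariant subspace [W]. *)
Lemma spectral_decomposition u : W u ->
  exists (s : seq R) (E : R -> F),
  [/\ uniq s, u = \sum_(x <- s) E x &
      forall x, x \in s -> W (E x) /\ opK K (E x) = x *: E x].
Proof.
have [s us su] := symmetric_annihilator Ksym => Wu.
suff [E [Eu EW]] : exists E : R -> F, u = \sum_(x <- s) E x /\
    forall x, x \in s -> W (E x) /\ opK K (E x) = x *: E x by exists s, E.
move: (su u) => {su}; elim: s u us Wu => [|x s IH] u /=.
  by move=> _ _ ->; exists (fun=> 0); rewrite big_nil.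
case/andP=> xs us Wu su.
have Wu' : W (opK K u - x *: u) by apply: subspaceB (WK Wu) (subspaceZ x Wu).
have [E' [E'u E'W]] := IH _ us Wu' su.
pose E y := (y - x)^-1 *: E' y.
have EW y : y \in s -> W (E y) /\ opK K (E y) = y *: E y.
  move=> /E'W [WE' TE']; split; first exact: subspaceZ.
  by rewrite linearZ /= TE' !scalerA mulrC.
pose Ex := u - \sum_(y <- s) E y.
exists (fun y => if y == x then Ex else E y); split.
  rewrite big_cons eqxx (eq_big_seq E) ?subrK // => y ys.
  by case: eqP ys => // ->; rewrite (negbTE xs).
move=> y; rewrite inE; case: eqP => [-> _|_ /= /EW //].
split; first by apply: subspaceB Wu (subspace_sum _) => z /EW[].
have -> : opK K Ex = opK K u - (\sum_(y <- s) E' y + x *: \sum_(y <- s) E y).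
  rewrite linearB linear_sum scaler_sumr -big_split; congr (_ - _).
  apply: eq_big_seq => z zs /=; have [_ ->] := EW z zs.
  apply/eqP; rewrite -subr_eq -scalerBl scalerA divff ?scale1r // subr_eq0.
  by apply: contraNneq xs => <-.
by rewrite -E'u scalerBr opprD opprB addrA [_ + (_ - _)]addrC subrK.
Qed.

Lemma eigenvectors_orthogonal x y u v :
  opK K u = x *: u -> opK K v = y *: v -> x != y -> ip u v = 0.
Proof.
move=> Tu Tv xy; have := ip_opK u v Ksym; rewrite Tu Tv ipZl ipZr => /eqP.
by rewrite -subr_eq0 -mulrBl mulf_eq0 subr_eq0 (negbTE xy) => /eqP.
Qed.

(** By orthogonality of the eigencomponents, [<u, S u>] is the sum of the [sigma x |E x|^2]. The
    sign of [sigma x] is asked only for eigenvectors not orthogonal to [u], so an exceptional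
    eigenspace can be dismissed by showing that [u] is orthogonal to it. *)
Lemma spectral_nonneg u (S : F -> F) (sigma : R -> R) : W u -> linear S ->
  (forall x v, opK K v = x *: v -> S v = sigma x *: v) ->
  (forall x v, W v -> opK K v = x *: v -> ip u v != 0 -> 0 <= sigma x) ->
  0 <= ip u (S u).
Proof.
move=> Wu Slin Ssig Spos; have [s [E [us uE EW]]] := spectral_decomposition Wu.
pose Sl : {linear F -> F} := HB.pack S (GRing.isLinear.Build R F F _ S Slin).
have uEx x : x \in s -> ip u (E x) = ip (E x) (E x).
  move=> xs; rewrite uE ipC linear_sum (big_rem _ xs) /= [X in _ + X]big1_seq ?addr0 //.
  move=> y /=; rewrite mem_rem_uniq // inE => /andP[yx ys].
  by apply: eigenvectors_orthogonal (EW x xs).2 (EW y ys).2 _; rewrite eq_sym.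
rewrite {2}uE -[S]/(Sl : F -> F) linear_sum linear_sum big_seq sumr_ge0 // => x xs.
have [WE TE] := EW x xs; rewrite /= (Ssig x) // ipZr.
have [->|uEN0] := eqVneq (ip u (E x)) 0; first by rewrite mulr0.
by rewrite mulr_ge0 ?(Spos x (E x)) // uEx // ip_ge0.
Qed.

Lemma opK_solve u : W u ->
  (forall v, W v -> opK K v = 0 -> v = 0) -> exists2 v, W v & opK K v = u.
Proof.
move=> Wu inj; have [s [E [us uE EW]]] := spectral_decomposition Wu.
(* The convention [0^-1 = 0] is harmless: the component for the eigenvalue [0] vanishes by
   injectivity. *)
exists (\sum_(x <- s) x^-1 *: E x).
  by apply: subspace_sum => x /EW[WE _]; apply: subspaceZ.
rewrite linear_sum uE; apply: eq_big_seq => x xs; rewrite linearZ /=.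
have [WE TE] := EW x xs; rewrite TE scalerA.
have [x0|xN0] := eqVneq x 0; last by rewrite mulVf ?scale1r.
by rewrite [E x]inj ?scaler0 // TE x0 scale0r.
Qed.

End Invariant.
End Kernel.
End Spectral.

(** * Regular tripartite complexes *)

Lemma ord3_third (i j l k : 'I_3) :
  i != j -> i != l -> j != l -> k != i -> k != j -> k = l.
Proof.
by move: i j l k; do 4! case=> [[|[|[|?]]] ?] //=; move=> *; apply/val_inj.
Qed.

Lemma natr_boolM (R : pzSemiRingType) (b : bool) : b%:R * b%:R = b%:R :> R.
Proof. by case: b; rewrite ?mulr1 ?mulr0. Qed.

(** For [N = N0], the eigenvalue of [Adj] where the Laplacian vanishes: excluding it gives
    connectedness. *)
Lemma outside_spec0 (R : realFieldType) (N m : R) : 0 < N -> m < N ->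
  `|N| <= m \/ N = - (N / 2) -> False.
Proof. by move=> ? ? [/ler_normlW|]; lra. Qed.

(** For [N = N1], the eigenvalue of [T1] on harmonic edge forms: excluding it makes the first
    cohomology vanish. *)
Lemma outside_spec1 (R : realFieldType) (N m : R) : 0 < N -> m < N ->
  [\/ `|N| <= m, `|N + N| <= m | N = - (2 * N)] -> False.
Proof. by move=> ? ? [/ler_normlW|/ler_normlW|]; lra. Qed.

Lemma sum3_swap12 (M : nmodType) (V : finType) (G : V -> V -> V -> M) :
  \sum_x \sum_y \sum_z G x y z = \sum_x \sum_y \sum_z G y x z.
Proof. exact: exchange_big. Qed.

Lemma sum3_swap23 (M : nmodType) (V : finType) (G : V -> V -> V -> M) :
  \sum_x \sum_y \sum_z G x y z = \sum_x \sum_y \sum_z G x z y.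
Proof. by apply: eq_bigr => x _; exact: exchange_big. Qed.

Lemma sum3_rot (M : nmodType) (V : finType) (G : V -> V -> V -> M) :
  \sum_x \sum_y \sum_z G x y z = \sum_x \sum_y \sum_z G y z x.
Proof. by rewrite sum3_swap23 sum3_swap12. Qed.

Section Tripartite.
Variables (R : rcfType) (V : finType) (adj : rel V) (tri : V -> V -> V -> bool).
Variables (part : V -> 'I_3) (N0 N1 : R).

Local Notation n := (GRing.natmul (GRing.one R) #|V|).
Local Notation a x y := (GRing.natmul (GRing.one R) (adj x y)).
Local Notation t x y z := (GRing.natmul (GRing.one R) (tri x y z)).
Local Notation bl i x := (GRing.natmul (GRing.one R) (part x == i)).
Local Notation ind A x := (GRing.natmul (GRing.one R) (x \in A)).
Local Notation F0 := {ffun V -> R^o}.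
Local Notation F1 := {ffun V * V -> R^o}.

Hypotheses (V_gt0 : (0 < #|V|)%N) (N0_gt0 : 0 < N0) (N1_gt0 : 0 < N1).
Hypothesis adjC : forall x y, adj x y = adj y x.
Hypothesis tri12 : forall x y z, tri x y z = tri y x z.
Hypothesis tri23 : forall x y z, tri x y z = tri x z y.
Hypothesis tri_part : forall x y z, tri x y z -> part x != part y.
Hypothesis adj_deg : forall x, \sum_y a x y = N0.
Hypothesis tri_deg : forall x y, \sum_z t x y z = N1 * a x y.

Lemma n_gt0 : 0 < n. Proof. by rewrite ltr0n. Qed.
Lemma N0_ge0 : 0 <= N0. Proof. exact: ltW. Qed.
Lemma n_neq0 : n != 0. Proof. by rewrite gt_eqF ?n_gt0. Qed.
Lemma N0_neq0 : N0 != 0. Proof. by rewrite gt_eqF ?N0_gt0. Qed.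
Lemma N1_neq0 : N1 != 0. Proof. by rewrite gt_eqF ?N1_gt0. Qed.

Lemma tri13 x y z : tri x y z = tri z y x.
Proof. by rewrite tri12 tri23 tri12. Qed.

Lemma tri_adj x y z : tri x y z -> adj x y.
Proof.
move=> txyz; apply: contraT => /negbTE xy; have /eqP := tri_deg x y.
rewrite xy mulr0 psumr_eq0 // => /allP /(_ z (mem_index_enum _)) /=.
by rewrite txyz oner_eq0.
Qed.

Lemma triM_adj x y z : t x y z * a x y = t x y z.
Proof. by case: (boolP (tri x y z)) => [/tri_adj ->|_]; rewrite ?mulr1 ?mul0r. Qed.

(** As [N1] is positive, every edge lies in a triangle, whose vertices are in distinct blocks. *)
Lemma adj_part x y : adj x y -> part x != part y.
Proof.
move=> xy; have : \sum_z t x y z != 0 by rewrite tri_deg xy mulr1 N1_neq0.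
by apply: contraNN => /eqP pxy; rewrite big1 // => z _;
  case: (boolP (tri x y z)) => // /tri_part; rewrite pxy eqxx.
Qed.

Lemma tri_parts x y z : tri x y z ->
  [/\ part x != part y, part x != part z & part y != part z].
Proof.
move=> h; split; first exact: tri_part h; first by apply: (@tri_part _ _ y); rewrite tri23.
by apply: (@tri_part _ _ x); rewrite tri23 tri12.
Qed.

Lemma tri_third x y z i j l : i != j -> i != l -> j != l -> tri x y z ->
  part x = i -> part y = j -> part z = l.
Proof.
move=> ij il jl txyz xi yj; have [_ xz yz] := tri_parts txyz.
by apply: (@ord3_third i j l); rewrite // eq_sym -?xi -?yj.
Qed.

(** The link of [x] is a graph between the blocks [j] and [l] in which every neighbour of [x] has
    degree [N1]. As [h] is constant along link edges, [N1] times either side is the sum of [h] over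
    these edges. *)
Lemma link_balance x j l (h : V -> R) : part x != j -> part x != l -> j != l ->
  (forall y z, tri x y z -> h y = h z) ->
  \sum_y a x y * bl j y * h y = \sum_y a x y * bl l y * h y.
Proof.
move=> xj xl jl hh; apply: (mulfI N1_neq0); rewrite !mulr_sumr.
transitivity (\sum_y \sum_z t x y z * bl j y * bl l z * h y).
  apply: eq_bigr => y _; rewrite !mulrA -tri_deg !mulr_suml; apply: eq_bigr => z _.
  case: (boolP (tri x y z)) => [txyz|_]; last by rewrite !mul0r.
  have [_ xz yz] := tri_parts txyz; case: (eqVneq (part y) j) => [yj|_];
    last by rewrite !(mul0r, mulr0).
  by rewrite (@ord3_third (part x) j l (part z)) ?eqxx ?mul1r // eq_sym // -yj.
rewrite exchange_big; apply: eq_bigr => y _ /=; rewrite !mulrA -tri_deg !mulr_suml.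
apply: eq_bigr => z _; rewrite tri23.
case: (boolP (tri x y z)) => [txyz|_]; last by rewrite !mul0r.
have [_ xz yz] := tri_parts txyz; case: (eqVneq (part y) l) => [yl|_];
  last by rewrite !(mul0r, mulr0).
rewrite (@ord3_third (part x) l j (part z)) ?eqxx ?mul1r //; first by rewrite (hh _ _ txyz).
- by rewrite eq_sym.
- by rewrite eq_sym.
- by rewrite eq_sym -yl.
Qed.

Lemma sum_bl x : \sum_(i : 'I_3) bl i x = 1.
Proof.
rewrite (bigD1 (part x)) //= eqxx big1 ?addr0 // => i.
by rewrite eq_sym => /negbTE ->.
Qed.

Lemma sum_blE (h : V -> R) : \sum_x h x = \sum_(i : 'I_3) \sum_x h x * bl i x.
Proof.
rewrite exchange_big; apply: eq_bigr => x _.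
by rewrite -mulr_sumr sum_bl mulr1.
Qed.

(** Balancing with weight [1] splits the [N0] neighbours of [x] evenly between the two other
    blocks. *)
Lemma half_degree x j : \sum_y a x y * bl j y = N0 / 2 * (part x != j)%:R.
Proof.
case: (eqVneq (part x) j) => [xj|xj].
  rewrite mulr0 big1 // => y _; case: (boolP (adj x y)) => [/adj_part|_]; last by rewrite mul0r.
  by rewrite xj eq_sym => /negbTE ->; rewrite mulr0.
rewrite mulr1.
have [l [xl jl]] : exists l, part x != l /\ j != l.
  move: (part x) j xj; do 2! case=> [[|[|[|?]]] ?] //=; move=> _; by
  [exists 0|exists 1|exists 2%:R].
have := @link_balance x j l (fun=> 1) xj xl jl (fun _ _ _ => erefl).
under eq_bigr do rewrite mulr1; under [RHS]eq_bigr do rewrite mulr1.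
have h0 : \sum_y a x y * bl (part x) y = 0.
  apply: big1 => y _; case: (boolP (adj x y)) => [/adj_part|_]; last by rewrite mul0r.
  by rewrite eq_sym => /negbTE ->; rewrite mulr0.
have := adj_deg x; rewrite sum_blE (bigD1 (part x)) //= (bigD1 j) 1?eq_sym //=.
rewrite (bigD1 l) /=; last by rewrite 2!(eq_sym l) xl jl.
rewrite [X in _ + (_ + (_ + X))]big1 ?addr0.
  by rewrite h0 add0r => <- <-; field.
by move=> i /andP[/andP[ix ij] il]; rewrite (@ord3_third (part x) j l i) ?eqxx in il.
Qed.

Lemma half_degree_neq x j : part x != j -> N0 / 2 = \sum_y a x y * bl j y.
Proof. by move=> xj; rewrite half_degree xj mulr1. Qed.

(** The edges between two blocks, counted from either side, force the blocks to have equal size. *)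
Lemma block_size i : \sum_x bl i x = n / 3.
Proof.
have eqb j l : j != l -> \sum_x bl j x = \sum_x bl l x.
  move=> jl.
  have e i' j' : i' != j' -> \sum_x \sum_y bl i' x * a x y * bl j' y = N0 / 2 * \sum_x bl i' x.
    move=> ij; rewrite mulr_sumr; apply: eq_bigr => x _.
    under eq_bigr do rewrite -mulrA; rewrite -mulr_sumr half_degree.
    by case: eqVneq => [->|_]; rewrite ?ij ?mulr1 ?mul1r ?mul0r ?mulr0.
  have N02 : N0 / 2 != 0 by rewrite mulf_neq0 ?N0_neq0 ?invr_neq0 ?pnatr_eq0.
  apply: (mulfI N02); rewrite -(e j l) // -(e l j) 1?eq_sym // exchange_big; apply: eq_bigr => x _.
  by apply: eq_bigr => y _; rewrite adjC; ring.
have : \sum_(x : V) 1 = \sum_(j : 'I_3) \sum_x bl i x.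
  rewrite sum_blE; apply: eq_bigr => j _.
  under eq_bigr do rewrite mul1r.
  by case: (eqVneq j i) => [->//|/eqb].
rewrite !sumr_const card_ord => ->.
by rewrite -[X in X / 3]mulr_natr mulfK ?pnatr_eq0.
Qed.


Definition Adj (phi : F0) : F0 := opK (fun x y => a x y) phi.
HB.instance Definition _ :=
  GRing.isLinear.Build R F0 F0 _ Adj (opK_linear (fun x y => a x y)).

Lemma AdjE phi x : Adj phi x = \sum_y a x y * phi y.
Proof. by rewrite ffunE. Qed.

Lemma adj_sym_ker x y : a x y = a y x.
Proof. by rewrite adjC. Qed.

Lemma ip_Adj phi psi : ip (Adj phi) psi = ip phi (Adj psi).
Proof. exact: ip_opK adj_sym_ker. Qed.

Definition Z0 (phi : F0) := \sum_x phi x = 0 :> R.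

Lemma Z0_subspace : subspace Z0.
Proof.
split=> [|c f g]; first by apply: big1 => x _; rewrite ffunE.
rewrite /Z0 => Zf Zg; under eq_bigr do rewrite !ffunE.
by rewrite big_split /= -scaler_sumr Zf Zg scaler0 addr0.
Qed.

Lemma Z0_Adj phi : Z0 phi -> Z0 (Adj phi).
Proof.
rewrite /Z0 => Zphi; under eq_bigr do rewrite AdjE.
transitivity (N0 * \sum_x phi x); last by rewrite Zphi mulr0.
rewrite exchange_big mulr_sumr; apply: eq_bigr => y _ /=.
by rewrite -mulr_suml -(adj_deg y); under eq_bigr do rewrite adjC.
Qed.

Definition block_orth (phi : F0) := forall i, \sum_x phi x * bl i x = 0.

Lemma block_orth_Z0 phi : block_orth phi -> Z0 phi.
Proof. by move=> h; rewrite /Z0 sum_blE big1 // => i _. Qed.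

Lemma block_fun_expand (c : 'I_3 -> R) x : c (part x) = \sum_i c i * bl i x.
Proof.
rewrite (bigD1 (part x)) //= eqxx mulr1 big1 ?addr0 // => i.
by rewrite eq_sym => /negbTE ->; rewrite mulr0.
Qed.

Lemma block_orthP phi (c : 'I_3 -> R) :
  block_orth phi -> \sum_x phi x * c (part x) = 0.
Proof.
move=> h; under eq_bigr do rewrite block_fun_expand mulr_sumr.
rewrite exchange_big big1 // => i _.
by under eq_bigr do rewrite mulrCA; rewrite -mulr_sumr h mulr0.
Qed.

Lemma tri_rot x y z : tri y z x = tri x y z.
Proof. by rewrite tri23 tri12. Qed.

(* [N0 + 2 Adj] is, up to a positive factor, the sum over all triangles of the squared
   triangle sums, so [- N0 / 2] is the least possible eigenvalue of [Adj]. *)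
Lemma triangle_sums0 psi : Adj psi = - (N0 / 2) *: psi ->
  forall x y z, tri x y z -> psi x + psi y + psi z = 0.
Proof.
move=> Apsi.
(* The three rotations of [H] add up to the squared triangle sum, while each has total
   [N1 (N0 |psi|^2 + 2 <psi, Adj psi>)], which is zero at this eigenvalue. *)
pose H x y z := t x y z * (psi x ^+ 2 + 2 * (psi x * psi y)).
pose S := \sum_x \sum_y \sum_z t x y z * (psi x + psi y + psi z) ^+ 2.
have Q0 : \sum_x \sum_y \sum_z H x y z = 0.
  transitivity (N1 * (N0 * ip psi psi + 2 * ip psi (Adj psi))).
    rewrite /ip !mulr_sumr -big_split mulr_sumr; apply: eq_bigr => x _ /=.
    rewrite AdjE -(adj_deg x) mulr_suml !mulr_sumr -big_split mulr_sumr.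
    apply: eq_bigr => y _ /=; rewrite /H -mulr_suml tri_deg; ring.
  by rewrite Apsi ipZr; field.
have S0 : S = 0.
  transitivity (\sum_x \sum_y \sum_z (H x y z + H y z x + H z x y)).
    apply: eq_bigr => x _; apply: eq_bigr => y _; apply: eq_bigr => z _.
    by rewrite /H (tri_rot x y z) -(tri_rot z x y); ring.
  under eq_bigr do (under eq_bigr do rewrite !big_split; rewrite !big_split).
  rewrite !big_split /= -(sum3_rot H) Q0 -(sum3_rot (fun x y z => H y z x)) -(sum3_rot H) Q0.
  by rewrite !addr0.
move=> x y z txyz; apply/eqP; rewrite -sqrf_eq0.
have term_ge0 u v w : 0 <= t u v w * (psi u + psi v + psi w) ^+ 2.
  by rewrite mulr_ge0 ?sqr_ge0.
have /eqP := S0; rewrite psumr_eq0 => [/allP/(_ x (mem_index_enum _))/=|u _]; last first.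
  by do 2! apply: sumr_ge0 => ? _.
rewrite psumr_eq0 => [/allP/(_ y (mem_index_enum _))/=|u _]; last exact: sumr_ge0.
rewrite psumr_eq0 // => /allP/(_ z (mem_index_enum _))/=.
by rewrite txyz mul1r.
Qed.

(** * Spectral bounds for the adjacency operator *)

Section GraphSpectrum.
Variables (mu0 : R) (mu0_ge0 : 0 <= mu0).
(** An eigenvalue [x] of [Adj] is [N0] minus an eigenvalue of the Laplacian: the interval becomes
    [|x| <= mu0], and [3 N0 / 2] becomes [- N0 / 2]. *)
Hypothesis spec0 : forall (phi : F0) x, Z0 phi -> phi != 0 -> Adj phi = x *: phi ->
  `|x| <= mu0 \/ x = - (N0 / 2).

Lemma ip_neq0r (I : finType) (u v : {ffun I -> R^o}) : ip u v != 0 -> v != 0.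
Proof. by apply: contraNneq => ->; rewrite ip0r. Qed.

(** The exceptional eigenvalue [- N0 / 2] is negative, so the upper bound holds on all of [Z0],
    whatever its eigenspace may be. *)
Lemma Adj_le phi : Z0 phi -> ip phi (Adj phi) <= mu0 * ip phi phi.
Proof.
move=> Zphi; rewrite -subr_ge0 -ipZr -ipBr.
apply: (@spectral_nonneg _ _ _ _ adj_sym_ker Z0_subspace Z0_Adj _
  (fun f => mu0 *: f - Adj f) (fun x => mu0 - x)) => //.
- by move=> c f g; rewrite [Adj _]linearP scalerDr scalerBr opprD addrACA !scalerA mulrC.
- by move=> x v Av; rewrite /Adj Av scalerBl.
move=> x v Zv Av /ip_neq0r v0; rewrite subr_ge0.
have [/ler_normlW //|->] := spec0 Zv v0 Av.
by apply: le_trans mu0_ge0; rewrite oppr_le0 divr_ge0 ?N0_ge0.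
Qed.

(** Expresses in dual form that eigenfunctions for [- N0 / 2] are constant on blocks: they are
    orthogonal to all that is orthogonal to the block functions. This is the form in which
    [spectral_nonneg] discards an eigenspace. *)
Definition block_eigenspace := forall psi u, Z0 psi ->
  Adj psi = - (N0 / 2) *: psi -> block_orth u -> ip u psi = 0.

(** Orthogonality to block functions removes the exceptional eigenspace; all other eigenvalues are
    at most [mu0] in absolute value. *)
Lemma Adj_block_orth phi : block_eigenspace -> block_orth phi ->
  ip (Adj phi) (Adj phi) <= mu0 ^+ 2 * ip phi phi.
Proof.
move=> blk bphi; rewrite ip_Adj -subr_ge0 -ipZr -ipBr.
apply: (@spectral_nonneg _ _ _ _ adj_sym_ker Z0_subspace Z0_Adj _
  (fun f => mu0 ^+ 2 *: f - Adj (Adj f)) (fun x => mu0 ^+ 2 - x ^+ 2)) => //.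
- exact: block_orth_Z0.
- by move=> c f g;
  rewrite [Adj (_ + _)]linearP [Adj (_ + _)]linearP scalerDr scalerBr opprD addrACA !scalerA mulrC.
- by move=> x v Av; rewrite /Adj Av linearZ /= Av scalerA scalerBl.
move=> x v Zv Av uv; rewrite subr_ge0.
have [h|h] := spec0 Zv (ip_neq0r uv) Av.
  by rewrite -[x ^+ 2]real_normK ?num_real // lerXn2r ?nnegrE.
by move: uv; rewrite blk ?eqxx // -h.
Qed.

(** * Edge counts and the expander mixing lemma *)

Definition edge_count (A B : {set V}) : R := \sum_x \sum_y ind A x * a x y * ind B y.

Lemma edge_countC A B : edge_count A B = edge_count B A.
Proof.
rewrite /edge_count exchange_big; apply: eq_bigr => x _; apply: eq_bigr => y _.
by rewrite adjC; ring.
Qed.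

Lemma sum_ind (A : {set V}) : \sum_x ind A x = #|A|%:R.
Proof.
rewrite -sum1_card natr_sum [RHS]big_mkcond; apply: eq_bigr => x _.
by case: (x \in A).
Qed.

Definition in_block (A : {set V}) (i : 'I_3) := forall x, x \in A -> part x = i.

Lemma ind_bl (A : {set V}) i x : in_block A i ->
  ind A x * bl i x = ind A x.
Proof. by move=> h; case: (boolP (x \in A)) => [/h ->|_]; rewrite ?eqxx ?mulr1 ?mul0r. Qed.

Lemma ind_bl0 (A : {set V}) i j x : in_block A i -> i != j ->
  ind A x * bl j x = 0.
Proof.
move=> h ij; case: (boolP (x \in A)) => [/h ->|_]; last by rewrite mul0r.
by rewrite (negbTE ij) mulr0.
Qed.

(** Removing from the indicator of [A] its mean over the block leaves a [w] orthogonal to block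
    functions. The removed part gives the expected count by [half_degree]; the rest is bounded by
    Cauchy-Schwarz and [Adj_block_orth]. *)
Lemma mixing A B i j : block_eigenspace -> i != j ->
  in_block A i -> in_block B j ->
  `|edge_count A B - 3 * N0 * #|A|%:R * #|B|%:R / (2 * n)|
    <= mu0 * Num.sqrt (#|A|%:R * #|B|%:R).
Proof.
move=> blk ij Ai Bj; set al := #|A|%:R; set be := #|B|%:R.
(* The density of [A] in its block of [n / 3] vertices is [3 al / n]. *)
pose w : F0 := [ffun x => ind A x - 3 * al / n * bl i x].
pose B1 : F0 := [ffun x => ind B x].
have bo_w : block_orth w.
  move=> l; under eq_bigr do rewrite ffunE mulrBl; rewrite sumrB.
  have [<-|il] := eqVneq i l.
    under eq_bigr do rewrite ind_bl //; rewrite sum_ind.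
    have -> : \sum_x 3 * al / n * bl i x * bl i x = 3 * al / n * (n / 3).
      rewrite -(block_size i) mulr_sumr; apply: eq_bigr => x _.
      by case: (part x == i); rewrite ?mulr1 ?mulr0.
    by rewrite -/al; field; rewrite n_neq0.
  rewrite !big1 ?subr0 // => x _; last by rewrite (ind_bl0 _ Ai il).
  case: eqVneq => [->|_]; last by rewrite mulr0 mul0r.
  by rewrite (negbTE il) mulr0.
have ww : ip w w <= al.
  have -> : ip w w = al - 3 * al ^+ 2 / n.
    transitivity (\sum_x (ind A x - 3 * al / n * ind A x) - 3 * al / n * \sum_x w x * bl i x).
      rewrite mulr_sumr -sumrB; apply: eq_bigr => x _; rewrite !ffunE -(ind_bl x Ai).
      by case: (x \in A); case: (part x == i); rewrite /= ?(mulr1, mul1r, mulr0, mul0r); ring.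
    rewrite bo_w mulr0 subr0 sumrB -mulr_sumr sum_ind -/al; field; exact: n_neq0.
  by rewrite gerBl divr_ge0 ?ler0n // mulr_ge0 ?sqr_ge0.
have Bip : ip B1 B1 = be.
  by rewrite /be -sum_ind; apply: eq_bigr => x _; rewrite !ffunE natr_boolM.
have -> : edge_count A B - 3 * N0 * al * be / (2 * n) = ip (Adj w) B1.
  rewrite ipC edge_countC /ip.
  have -> : 3 * N0 * al * be / (2 * n) = \sum_x ind B x * (3 * al / n * (N0 / 2)).
    by rewrite -mulr_suml sum_ind -/be; field; rewrite n_neq0.
  rewrite /edge_count -sumrB; apply: eq_bigr => x _; rewrite AdjE ffunE.
  transitivity (ind B x * (\sum_y a x y * ind A y - 3 * al / n * \sum_y a x y * bl i y)).
    rewrite half_degree mulrBr mulr_sumr.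
    under eq_bigr do rewrite -mulrA; congr (_ - _).
    case: (boolP (x \in B)) => [/Bj ->|_]; last by rewrite !mul0r.
    by rewrite eq_sym ij mulr1.
  congr (_ * _); rewrite mulr_sumr -sumrB; apply: eq_bigr => y _; rewrite ffunE; ring.
apply: le_trans (cauchy_schwarz _ _) _; rewrite Bip.
rewrite sqrtrM ?ler0n // mulrA ler_wpM2r ?sqrtr_ge0 //.
have -> : mu0 * Num.sqrt al = Num.sqrt (mu0 ^+ 2 * al).
  by rewrite sqrtrM ?sqr_ge0 // sqrtr_sqr ger0_norm.
apply: ler_wsqrtr; apply: le_trans (Adj_block_orth blk bo_w) _.
by rewrite ler_wpM2l ?sqr_ge0.
Qed.

Lemma edge_count_ge0 A B : 0 <= edge_count A B.
Proof. by do 2! apply: sumr_ge0 => ? _; rewrite !mulr_ge0. Qed.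

Lemma edge_count_lel A B j : in_block B j -> edge_count A B <= N0 / 2 * #|A|%:R.
Proof.
move=> Bj; rewrite -sum_ind mulr_sumr; apply: ler_sum => x _.
under eq_bigr do rewrite -mulrA; rewrite -mulr_sumr mulrC ler_wpM2r //.
apply: (@le_trans _ _ (\sum_y a x y * bl j y)).
  apply: ler_sum => y _; rewrite -(ind_bl y Bj) ler_wpM2l //.
  by case: (y \in B); rewrite ?mul1r ?mul0r.
by rewrite half_degree ler_piMr ?divr_ge0 ?N0_ge0 // lern1 leq_b1.
Qed.

(** The geometric mean of the degree bounds taken from the two sides. *)
Lemma edge_count_le A B i j : in_block A i -> in_block B j ->
  edge_count A B <= N0 / 2 * Num.sqrt (#|A|%:R * #|B|%:R).
Proof.
move=> Ai Bj; have N02 : 0 <= N0 / 2 by rewrite divr_ge0 ?N0_ge0.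
rewrite -(ger0_norm (edge_count_ge0 A B)) -sqrtr_sqr -[N0 / 2](ger0_norm N02) -sqrtr_sqr.
rewrite -sqrtrM ?sqr_ge0 // ler_wsqrtr // [X in _ <= X](_ : _ = (N0 / 2 * #|A|%:R) * (N0 / 2 *
  #|B|%:R)); last ring.
by rewrite expr2 ler_pM ?edge_count_ge0 ?(edge_count_lel _ Bj) // edge_countC (edge_count_lel _ Ai).
Qed.

(* Testing [Adj] on [(f_i, - f_j, 0)] for the three pairs of blocks gives
   [N0 / 2 * |f|^2 <= 2 * mu0 * |f|^2]. *)
Lemma block_eigenspace_small : mu0 < N0 / 4 -> block_eigenspace.
Proof.
move=> mu0N psi u Zpsi Apsi bu; have tri0 := triangle_sums0 Apsi.
(* [c i] is the mean of [psi] on block [i]. The means add up to zero and a triangle meets each block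
   once, so [f] inherits the vanishing triangle sums. *)
pose c i := 3 / n * \sum_x psi x * bl i x.
have sc : \sum_i c i = 0.
  by rewrite -mulr_sumr -sum_blE Zpsi mulr0.
pose f : F0 := [ffun x => psi x - c (part x)].
have f_tri x y z : tri x y z -> f x + f y + f z = 0.
  move=> txyz; have [xy xz yz] := tri_parts txyz; rewrite !ffunE.
  have : c (part x) + c (part y) + c (part z) = 0.
    rewrite -[RHS]sc (bigD1 (part x)) //= (bigD1 (part y)) 1?eq_sym //=.
    rewrite (bigD1 (part z)) /=; last by rewrite 2!(eq_sym (part z)) xz yz.
    rewrite big1 ?addr0 ?addrA // => i /andP[/andP[ix iy] iz].
    by rewrite (@ord3_third (part x) (part y) (part z) i) ?eqxx in iz.
  move=> h; rewrite -[RHS](tri0 _ _ _ txyz) -[RHS]subr0 -{1}h; ring.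
have bf : block_orth f.
  move=> i; under eq_bigr do rewrite ffunE mulrBl; rewrite sumrB.
  have -> : \sum_x c (part x) * bl i x = c i * (n / 3).
    rewrite -(block_size i) mulr_sumr; apply: eq_bigr => x _.
    by case: eqVneq => [->|_]; rewrite ?mulr0.
  by rewrite /c; field; rewrite n_neq0.
pose p i := \sum_x bl i x * f x ^+ 2.
have ineq i j l : i != j -> i != l -> j != l ->
    N0 / 2 * (p i + p j - p l) <= mu0 * (p i + p j).
  move=> ij il jl.
  pose g : F0 := [ffun x => (bl i x - bl j x) * f x].
  have Zg : Z0 g.
    rewrite /Z0; transitivity (\sum_x f x * bl i x - \sum_x f x * bl j x).
      by rewrite -sumrB; apply: eq_bigr => x _; rewrite ffunE; ring.
    by rewrite !bf subr0.
  have gg : ip g g = p i + p j.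
    rewrite /ip /p -big_split; apply: eq_bigr => x _; rewrite ffunE /=.
    case: (eqVneq (part x) i) => [->|_]; first by rewrite (negbTE ij) /=; ring.
    by case: (eqVneq (part x) j) => _ /=; ring.
  pose cij := \sum_x \sum_y a x y * (bl i x * bl j y) * (f x * f y).
  have gAg : ip g (Adj g) = - 2 * cij.
    transitivity (- cij - \sum_x \sum_y a x y * (bl j x * bl i y) * (f x * f y)).
      rewrite /ip -opprD -big_split -sumrN; apply: eq_bigr => x _ /=.
      rewrite AdjE -big_split mulr_sumr -sumrN; apply: eq_bigr => y _ /=.
      rewrite !ffunE; case: (boolP (adj x y)) => [/adj_part xy|_];
        last by rewrite !mul0r mulr0 addr0 oppr0.
      case: (eqVneq (part x) i) xy => [->|xi] xy.
        by rewrite (negbTE ij) (eq_sym (part y) i) (negbTE xy) /=; ring.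
      case: (eqVneq (part x) j) xy => [->|xj] xy; last by rewrite /=; ring.
      by rewrite (eq_sym (part y) j) (negbTE xy) /=; ring.
    rewrite [X in _ - X](_ : _ = cij); first ring.
    rewrite exchange_big; apply: eq_bigr => x _; apply: eq_bigr => y _ /=.
    by rewrite adjC; ring.
  have half q i' j' : i' != j' ->
      \sum_x \sum_y a x y * (bl i' x * bl j' y) * q x = N0 / 2 * \sum_x bl i' x * q x.
    move=> ij'; rewrite mulr_sumr; apply: eq_bigr => x _.
    transitivity (bl i' x * q x * \sum_y a x y * bl j' y).
      by rewrite mulr_sumr; apply: eq_bigr => y _; ring.
    by rewrite half_degree; case: eqVneq => [->|_]; rewrite ?ij' /=; ring.
  (* On a triangle [f x + f y = - f z]. An edge between the blocks [i] and [j] lies in [N1]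
     triangles, a vertex of block [l] in [N1 N0 / 2]. *)
  have key : \sum_x \sum_y a x y * (bl i x * bl j y) * (f x + f y) ^+ 2 = N0 / 2 * p l.
    apply: (mulfI N1_neq0).
    pose G x y z := t x y z * (bl i x * bl j y * bl l z * f z ^+ 2).
    transitivity (\sum_x \sum_y \sum_z G x y z).
      rewrite mulr_sumr; apply: eq_bigr => x _; rewrite mulr_sumr; apply: eq_bigr => y _.
      rewrite !mulrA -(mulrA (N1 * _)) -tri_deg !mulr_suml; apply: eq_bigr => z _; rewrite /G.
      case: (boolP (tri x y z)) => [txyz|_]; last by rewrite !mul0r.
      have [xy xz yz] := tri_parts txyz; have := f_tri _ _ _ txyz.
      case: (eqVneq (part x) i) => [xi|_]; last by rewrite !(mul0r, mulr0).
      case: (eqVneq (part y) j) => [yj|_]; last by rewrite !(mul0r, mulr0).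
      rewrite (tri_third ij il jl txyz xi yj) eqxx.
      move=> h; have -> : f z = - (f x + f y) by rewrite -[LHS]subr0 -h; ring.
      by rewrite /=; ring.
    rewrite (sum3_rot G) -(half (fun x => f x ^+ 2) l i) 1?eq_sym // mulr_sumr.
    apply: eq_bigr => x _; rewrite mulr_sumr; apply: eq_bigr => y _.
    rewrite !mulrA -tri_deg !mulr_suml; apply: eq_bigr => z _; rewrite /G tri_rot.
    case: (boolP (tri x y z)) => [txyz|_]; last by rewrite !mul0r.
    have [xy xz yz] := tri_parts txyz.
    case: (eqVneq (part x) l) => [xl|_]; last by rewrite !(mul0r, mulr0).
    case: (eqVneq (part y) i) => [yi|_]; last by rewrite !(mul0r, mulr0).
    rewrite (@tri_third _ _ _ l i j _ _ ij txyz) 1?eq_sym // eqxx.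
    by rewrite /=; ring.
  have expand : \sum_x \sum_y a x y * (bl i x * bl j y) * (f x + f y) ^+ 2
      = N0 / 2 * p i + N0 / 2 * p j + 2 * cij.
    rewrite -(half (fun x => f x ^+ 2) i j) // -(half (fun x => f x ^+ 2) j i) 1?eq_sym //.
    rewrite [X in _ + X + _]exchange_big /cij mulr_sumr -!big_split; apply: eq_bigr => x _ /=.
    rewrite mulr_sumr -!big_split; apply: eq_bigr => y _ /=; rewrite (adjC y x); ring.
  have := Adj_le Zg; rewrite gAg gg; move: key; rewrite expand; lra.
have ff : ip f f = \sum_i p i.
  rewrite /ip sum_blE; apply: eq_bigr => i _; apply: eq_bigr => x _; ring.
have f0 : f = 0.
  apply/ip_eq0/eqP; rewrite eq_le ip_ge0 andbT leNgt; apply/negP => P_gt0.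
  have P3 : ip f f = p ord0 + p (inord 1) + p ord_max.
    rewrite ff !big_ord_recl big_ord0 addr0 addrA; congr (_ + p _ + p _); apply/val_inj => //=.
    by rewrite inordK.
  have d1 : ord0 != inord 1 :> 'I_3 by rewrite -val_eqE /= inordK.
  have d2 : ord0 != ord_max :> 'I_3 by [].
  have d3 : inord 1 != ord_max :> 'I_3 by rewrite -val_eqE /= inordK.
  have ns (i j : 'I_3) : i != j -> j != i by rewrite eq_sym.
  have i1 := ineq _ _ _ d1 d2 d3; have i2 := ineq _ _ _ d2 d1 (ns _ _ d3).
  have i3 := ineq _ _ _ d3 (ns _ _ d1) (ns _ _ d2).
  have : N0 / 2 * ip f f <= 2 * mu0 * ip f f by rewrite P3; lra.
  rewrite ler_pM2r //; lra.
rewrite -(block_orthP c bu); apply: eq_bigr => x _; congr (_ * _).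
by apply/eqP; rewrite -subr_eq0; have /ffunP/(_ x) := f0; rewrite !ffunE => ->.
Qed.

(** * Functions on oriented edges *)

Lemma sum_delta (I : finType) (x : I) (G : I -> R) : \sum_y (x == y)%:R * G y = G x.
Proof.
rewrite (bigD1 x) //= eqxx mul1r big1 ?addr0 // => y.
by rewrite eq_sym => /negbTE ->; rewrite mul0r.
Qed.

Lemma ip_pair (f g : F1) : ip f g = \sum_x \sum_y f (x, y) * g (x, y).
Proof. by rewrite pair_bigA; apply: eq_bigr => -[]. Qed.

(* On [Omega1] the operator [T1] of this kernel is [N1 - Delta_1^+], just as [Adj] is
   [N0 - Delta_0^+]. *)
Definition K1 (p q : V * V) : R :=
  (p.1 == q.1)%:R * t p.1 p.2 q.2 + (p.2 == q.2)%:R * t p.1 p.2 q.1.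

Lemma K1_sym p q : K1 p q = K1 q p.
Proof.
case: p q => [x y] [u v]; rewrite /K1 /= (eq_sym u) (eq_sym v).
congr (_ + _); case: eqVneq => [->|_]; rewrite ?mul0r // !mul1r; first by rewrite tri23.
by rewrite tri13 (tri12 u) tri23.
Qed.

Definition T1 (f : F1) : F1 := opK K1 f.
HB.instance Definition _ := GRing.isLinear.Build R F1 F1 _ T1 (opK_linear K1).

Lemma T1E f x y : T1 f (x, y) = \sum_z t x y z * (f (x, z) + f (z, y)).
Proof.
rewrite ffunE; transitivity (\sum_u \sum_v K1 (x, y) (u, v) * f (u, v)).
  by rewrite pair_bigA; apply: eq_bigr => -[].
transitivity (\sum_u (x == u)%:R * (\sum_v t x y v * f (u, v))
    + \sum_v (y == v)%:R * (\sum_u t x y u * f (u, v))).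
  under [X in _ + X]eq_bigr do rewrite mulr_sumr.
  rewrite [X in _ + X]exchange_big -big_split; apply: eq_bigr => u _ /=.
  rewrite mulr_sumr -big_split; apply: eq_bigr => v _ /=; rewrite /K1 /=; ring.
by rewrite !sum_delta -big_split; apply: eq_bigr => z _ /=; ring.
Qed.

Lemma ip_T1 f g : ip (T1 f) g = ip f (T1 g).
Proof. exact: ip_opK K1_sym. Qed.

Definition Omega1 (f : F1) :=
  (forall x y, f (y, x) = - f (x, y)) /\ (forall x y, a x y * f (x, y) = f (x, y)).

Definition dl (phi : F0) : F1 := [ffun p => a p.1 p.2 * (phi p.2 - phi p.1)].
Definition bdy (f : F1) : F0 := [ffun y => \sum_x f (x, y)].
Definition Z1 (f : F1) := Omega1 f /\ bdy f = 0.

Lemma dl_linear : linear dl.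
Proof. by move=> c f g; apply/ffunP => p; rewrite !ffunE /GRing.scale /=; ring. Qed.
HB.instance Definition _ := GRing.isLinear.Build R F0 F1 _ dl dl_linear.

Lemma bdy_linear : linear bdy.
Proof.
move=> c f g; apply/ffunP => y; rewrite !ffunE scaler_sumr -big_split.
by apply: eq_bigr => x _; rewrite !ffunE.
Qed.
HB.instance Definition _ := GRing.isLinear.Build R F1 F0 _ bdy bdy_linear.

Lemma Omega1_subspace : subspace Omega1.
Proof.
split=> [|c f g [fs fa] [gs ga]]; split=> x y; rewrite !ffunE ?oppr0 ?mulr0 //.
  by rewrite fs gs /GRing.scale /=; ring.
by rewrite -{2}fa -{2}ga /GRing.scale /=; ring.
Qed.

Lemma Z1_subspace : subspace Z1.
Proof.
have [O0 Ol] := Omega1_subspace; split=> [|c f g [Of bf] [Og bg]]; split=> //.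
- by rewrite linear0.
- exact: Ol.
by rewrite [bdy _]linearP /= bf bg scaler0 addr0.
Qed.

Lemma dl_Omega1 phi : Omega1 (dl phi).
Proof.
split=> x y; rewrite !ffunE /=; first by rewrite adjC; ring.
by rewrite mulrA natr_boolM.
Qed.

(** The factor [2] appears because [ip] on pairs counts every edge in both orientations. *)
Lemma ip_dl phi f : Omega1 f -> ip (dl phi) f = 2 * ip phi (bdy f).
Proof.
move=> [fs fa]; rewrite ip_pair.
transitivity (\sum_x \sum_y phi y * f (x, y) + \sum_x \sum_y phi x * f (y, x)).
  rewrite -big_split; apply: eq_bigr => x _; rewrite -big_split; apply: eq_bigr => y _ /=.
  by rewrite ffunE /= (fs x y) -{2 3}fa; ring.
rewrite exchange_big -mulr2n -[LHS]mulr_natl; congr (_ * _); apply: eq_bigr => y _.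
by rewrite ffunE mulr_sumr.
Qed.

Lemma bdy_dl phi : bdy (dl phi) = N0 *: phi - Adj phi.
Proof.
apply/ffunP => y; rewrite ffunE ffBE ffZE AdjE -(adj_deg y) mulr_suml -sumrB.
by apply: eq_bigr => x _; rewrite ffunE /= adjC; ring.
Qed.

(** In a triangle the increments from [x] to [z] and from [z] to [y] add up to the one from [x] to
    [y]. Thus [Delta_1^+] kills coboundaries. *)
Lemma T1_dl phi : T1 (dl phi) = N1 *: dl phi.
Proof.
apply/ffunP => -[x y]; rewrite T1E ffZE [dl phi (x, y)]ffunE /= mulrA -tri_deg mulr_suml.
apply: eq_bigr => z _; rewrite !ffunE /=.
case: (boolP (tri x y z)) => [txyz|_]; last by rewrite !mul0r.
have -> : adj x z by apply: (@tri_adj _ _ y); rewrite tri23.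
have -> : adj z y by apply: (@tri_adj _ _ x); rewrite -tri_rot tri12.
by rewrite /=; ring.
Qed.

Lemma T1_Omega1 f : Omega1 f -> Omega1 (T1 f).
Proof.
move=> [fs fa]; split=> x y; rewrite !T1E.
  rewrite -sumrN; apply: eq_bigr => z _.
  by rewrite tri12 (fs z y) (fs x z) -mulrN opprD addrC.
by rewrite mulr_sumr; apply: eq_bigr => z _; rewrite mulrA [a x y * _]mulrC triM_adj.
Qed.

(** The terms [f (x, z)] cancel under the exchange of [x] and [z]. Dual to [T1_dl], this makes [Z1]
    invariant under [T1]. *)
Lemma bdy_T1 f : Omega1 f -> bdy (T1 f) = N1 *: bdy f.
Proof.
move=> [fs fa]; apply/ffunP => y; rewrite ffunE ffZE ffunE.
transitivity (\sum_x \sum_z t x y z * f (x, z) + \sum_x \sum_z t x y z * f (z, y)).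
  rewrite -big_split; apply: eq_bigr => x _; rewrite T1E -big_split.
  by apply: eq_bigr => z _; rewrite mulrDr.
have -> : \sum_x \sum_z t x y z * f (x, z) = 0.
  set s := \sum_x _; suff : s = - s by move=> h; lra.
  rewrite {1}/s exchange_big -sumrN; apply: eq_bigr => x _; rewrite -sumrN.
  by apply: eq_bigr => z _; rewrite fs tri13 mulrN.
rewrite add0r exchange_big mulr_sumr; apply: eq_bigr => x _ /=.
rewrite -mulr_suml -[in RHS](fa x y) mulrA -tri_deg; congr (_ * _).
by apply: eq_bigr => z _; rewrite -tri_rot tri12.
Qed.

Lemma Z1_T1 f : Z1 f -> Z1 (T1 f).
Proof. by move=> [Of bf]; split; [exact: T1_Omega1|rewrite bdy_T1 // bf scaler0]. Qed.

Lemma bdy_Z0 f : Omega1 f -> Z0 (bdy f).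
Proof.
move=> [fs _]; rewrite /Z0; set s := \sum_x _; suff : s = - s by move=> h; lra.
rewrite /s; under eq_bigr do rewrite ffunE.
rewrite {1}exchange_big -sumrN; apply: eq_bigr => x _; rewrite -sumrN.
by apply: eq_bigr => z _; rewrite fs.
Qed.

Lemma Adj_N0 phi : mu0 < N0 -> Z0 phi -> Adj phi = N0 *: phi -> phi = 0.
Proof.
move=> mu0N Zphi Aphi; apply/eqP; apply: contraT => phi0.
by case: (outside_spec0 N0_gt0 mu0N (spec0 Zphi phi0 Aphi)).
Qed.

(** The boundary of a skew form has sum zero, and on functions of sum zero the Laplacian is
    injective, hence invertible: take the solution of [N0 phi - Adj phi = bdy f]. *)
Lemma hodge f : mu0 < N0 -> Omega1 f -> exists2 phi, Z0 phi & bdy (f - dl phi) = 0.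
Proof.
move=> mu0N Of.
pose K x y := N0 * (x == y)%:R - a x y.
have KE phi : opK K phi = N0 *: phi - Adj phi.
  apply/ffunP => x; rewrite ffunE ffBE ffZE AdjE -(sum_delta x phi) mulr_sumr -sumrB.
  by apply: eq_bigr => y _; rewrite /K; ring.
have Ksym x y : K x y = K y x by rewrite /K eq_sym adjC.
have Zsub := Z0_subspace.
have KZ phi : Z0 phi -> Z0 (opK K phi).
  by move=> Zphi; rewrite KE; apply: subspaceB (subspaceZ _ _ Zphi) (Z0_Adj Zphi).
have [|phi Zphi phiE] := opK_solve Ksym Zsub KZ (bdy_Z0 Of).
  by move=> v Zv /eqP; rewrite KE subr_eq0 => /eqP e; apply: Adj_N0.
by exists phi => //; rewrite linearB /= bdy_dl -KE phiE subrr.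
Qed.

(** Subtracting the mean of [h] leaves a function in [Z0] with [Adj]-eigenvalue [N0], which is
    zero. *)
Lemma connected_const (h : V -> R) : mu0 < N0 ->
  (forall x y, adj x y -> h x = h y) -> forall x y, h x = h y.
Proof.
move=> mu0N hh.
pose m := (\sum_x h x) / n; pose phi : F0 := [ffun x => h x - m].
suff phi0 : phi = 0.
  by move=> x y; have /ffunP e := phi0; have := e x; have := e y; rewrite !ffunE; lra.
apply: Adj_N0 => //.
  rewrite /Z0; under eq_bigr do rewrite ffunE; rewrite sumrB sumr_const -[m *+ _]mulr_natr.
  by rewrite /m divfK ?n_neq0 // subrr.
apply/ffunP => x; rewrite AdjE ffZE -(adj_deg x) mulr_suml; apply: eq_bigr => y _.
by case: (boolP (adj x y)) => [/hh e|_]; rewrite ?mul0r // !ffunE e.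
Qed.

(** * Spectral hypothesis on edge forms *)

Section EdgeSpectrum.
Variables (mu1 : R) (mu1_ge0 : 0 <= mu1).
(** An eigenvalue [x] of [T1] is [N1] minus an eigenvalue of [Delta_1^+]: the intervals around [N1]
    and [2 N1] move to [0] and [- N1], and [3 N1] becomes [- 2 N1]. *)
Hypothesis spec1 : forall (f : F1) x, Z1 f -> f != 0 -> T1 f = x *: f ->
  [\/ `|x| <= mu1, `|x + N1| <= mu1 | x = - (2 * N1)].

(** * Connectivity of the triangles through edges *)

Section StrongConnectivity.
Hypotheses (mu0N : mu0 < N0) (mu1N : mu1 < N1).
Variable S : V -> V -> bool.
Hypothesis SC : forall x y, S x y = S y x.
Hypothesis S_tri : forall x y z, tri x y z -> S x y = S x z.

(* [S] times a coboundary is closed, hence, as there is no harmonic form, a coboundary. *)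
Lemma cut_potential v : exists phi : F0, forall x y, adj x y ->
  phi y - phi x = (S x y)%:R * ((y == v)%:R - (x == v)%:R).
Proof.
pose u : F1 := [ffun p => a p.1 p.2 * (S p.1 p.2)%:R * ((p.2 == v)%:R - (p.1 == v)%:R)].
have Ou : Omega1 u.
  split=> x y; rewrite !ffunE /=; first by rewrite adjC SC; ring.
  by rewrite !mulrA natr_boolM.
(* [S] takes one value on the edges of a triangle, so there [u] is either a coboundary or zero. *)
have Tu : T1 u = N1 *: u.
  apply/ffunP => -[x y]; rewrite T1E ffZE [u (x, y)]ffunE /= !mulrA -tri_deg !mulr_suml.
  apply: eq_bigr => z _; rewrite !ffunE /=.
  case: (boolP (tri x y z)) => [txyz|_]; last by rewrite !mul0r.
  have txz : tri x z y by rewrite tri23.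
  have tzy : tri z y x by rewrite -tri_rot tri12.
  rewrite (tri_adj txz) (tri_adj tzy) -(S_tri txyz) (S_tri tzy) (SC z x) -(S_tri txyz) /=; ring.
have [phi Zphi bphi] := hodge mu0N Ou.
have u_dl : u - dl phi = 0.
  apply/eqP; apply: contraT => zN0.
  have Zz : Z1 (u - dl phi).
    by split=> //; apply: subspaceB Omega1_subspace _ _ Ou (dl_Omega1 phi).
  have Tz : T1 (u - dl phi) = N1 *: (u - dl phi) by rewrite linearB /= Tu T1_dl scalerBr.
  by case: (outside_spec1 N1_gt0 mu1N (spec1 Zz zN0 Tz)).
exists phi => x y xy; have /ffunP/(_ (x, y)) := u_dl.
by rewrite !ffunE /= xy /= !mul1r => /eqP; rewrite subr_eq0 => /eqP <-.
Qed.

(* Double counting the edges inside the level set of the potential through [v] shows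
   that the number of [S]-edges at [v] is an integer multiple of the degree. *)
Lemma cut_star v x y : adj v x -> adj v y -> S v x = S v y.
Proof.
have [phi phiE] := cut_potential v.
(* The level set of [phi] through [v]. Away from [v], [phi] is constant along edges, so the only
   edges leaving [om] are the [S]-edges at [v]. *)
pose om x := (phi x == phi v).
have om_v x' : adj v x' -> om x' = ~~ S v x'.
  move=> vx; have := phiE _ _ vx; rewrite /om -subr_eq0 => ->; rewrite eqxx.
  have -> : x' == v = false.
    by apply/negbTE; apply: contraTneq (adj_part vx) => ->; rewrite eqxx.
  by case: (S v x'); rewrite /= ?mul0r ?eqxx // mul1r sub0r oppr_eq0 oner_eq0.
have om_adj x' y' : x' != v -> om x' -> adj x' y' -> om y'.
  move=> x'v; have [->|y'v] := eqVneq y' v; first by rewrite /om eqxx.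
  move=> omx xy; have := phiE _ _ xy; rewrite (negbTE x'v) (negbTE y'v) subrr mulr0.
  by move/eqP; rewrite subr_eq0 /om => /eqP->.
(* [s j] counts the [S]-neighbours of [v] in block [j], [w i] the vertices of [om] in block [i], and
   [e i j] the edges inside [om] between the two blocks. Counting [e (part v) j] from both sides
   gives [s j = N0 / 2 (w (part v) - w j)]. *)
pose s j := \sum_y' a v y' * bl j y' * (S v y')%:R.
pose w i := \sum_x' bl i x' * (om x')%:R.
pose e i j := \sum_x' \sum_y' bl i x' * (om x')%:R * (a x' y' * (bl j y' * (om y')%:R)).
have eC i j : e i j = e j i.
  rewrite /e exchange_big; apply: eq_bigr => x' _; apply: eq_bigr => y' _.
  by rewrite adjC; ring.
have row i j x' : i != j -> x' != v ->
    \sum_y' bl i x' * (om x')%:R * (a x' y' * (bl j y' * (om y')%:R))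
    = bl i x' * (om x')%:R * (N0 / 2).
  move=> ij xv; rewrite -mulr_sumr.
  case: (eqVneq (part x') i) => [xi|_]; last by rewrite !mul0r.
  case: (boolP (om x')) => [omx|_]; last by rewrite mulr0 !mul0r.
  have -> : N0 / 2 = \sum_y' a x' y' * bl j y' by rewrite half_degree xi ij mulr1.
  congr (_ * _); apply: eq_bigr => y' _; case: (boolP (adj x' y')) => [xy|_];
    last by rewrite !mul0r.
  by rewrite (om_adj _ _ xv omx xy) mulr1.
have e1 i j : i != j -> part v != i -> e i j = N0 / 2 * w i.
  move=> ij vi; rewrite mulr_sumr; apply: eq_bigr => x' _.
  have [->|xv] := eqVneq x' v; last by rewrite row // mulrC.
  by rewrite (negbTE vi) !mul0r mulr0 big1 // => y' _; rewrite !mul0r.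
have e2 j : part v != j -> e (part v) j = N0 / 2 * w (part v) - s j.
  move=> vj; rewrite /e /w (bigD1 v) //= [in RHS](bigD1 v) //= mulrDr mulr_sumr.
  rewrite [X in _ + X](eq_bigr (fun x' => N0 / 2 * (bl (part v) x' * (om x')%:R))); last first.
    by move=> x' xv; rewrite row // mulrC.
  rewrite [in RHS]addrAC; congr (_ + _).
  rewrite /om eqxx -/om !eqxx !mul1r mulr1.
  rewrite (half_degree_neq vj).
  rewrite /s -sumrB; apply: eq_bigr => y' _; rewrite mul1r.
  case: (boolP (adj v y')) => [vy|_]; last by rewrite !mul0r subrr.
  by rewrite -/(om y') (om_v _ vy); case: (S v y') => /=; ring.
have wN i : w i = (\sum_x' ((part x' == i) && om x'))%N%:R.
  rewrite natr_sum; apply: eq_bigr => x' _.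
  by case: (part x' == i); case: (om x'); rewrite /= ?mulr1 ?mul0r ?mulr0.
have sle j : part v != j -> s j = N0 / 2 - \sum_y' a v y' * bl j y' * (~~ S v y')%:R.
  move=> vj; rewrite (half_degree_neq vj) -sumrB.
  by apply: eq_bigr => y' _; case: (S v y') => /=; ring.
(* As [w] takes integer values, [s j] is an integer multiple of [N0 / 2] between [0] and
   [N0 / 2]. *)
have s_int j : part v != j -> s j = 0 \/ s j = N0 / 2.
  move=> vj; have sw : s j = N0 / 2 * (w (part v) - w j).
    by have := e2 _ vj; rewrite eC (e1 _ _ _ vj) 1?eq_sym // mulrBr => ->; ring.
  have N02 : 0 < N0 / 2 by rewrite divr_gt0.
  have s_ge0 : 0 <= s j by apply: sumr_ge0 => y' _; rewrite !mulr_ge0.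
  have s_le : s j <= N0 / 2.
    by rewrite sle // gerBl; apply: sumr_ge0 => y' _; rewrite !mulr_ge0.
  move: s_ge0 s_le; rewrite sw pmulr_rge0 // subr_ge0 ger_pMr // lerBlDr addrC !wN natr1 !ler_nat.
  set q := (\sum_x' _)%N; set p := (\sum_x' _)%N => qp pq.
  have [->|->] : p = q \/ p = q.+1.
  - by move: qp; rewrite leq_eqVlt => /orP[/eqP|lt]; [left|right; apply/eqP; rewrite eqn_leq pq].
  - by left; rewrite subrr mulr0.
  - by right; rewrite -natr1; ring.
(* [S v] is constant along the link of [v], so both blocks not containing [v] have the same
   count. *)
have s_eq x' y' : adj v x' -> adj v y' -> s (part x') = s (part y').
  move=> /adj_part vx /adj_part vy; have [->//|xy] := eqVneq (part x') (part y').
  by apply: link_balance => // y'' z'' /S_tri ->.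
wlog Sx : x y / S v x.
  move=> hwlog vx vy; case: (boolP (S v x)) => [Sx|Sx].
    by rewrite -(hwlog x y).
  by case: (boolP (S v y)) => // Sy; have := hwlog y x Sy vy vx; rewrite Sy (negbTE Sx).
move=> vx vy; rewrite Sx; apply/esym/negPn/negP => Sy.
have term_ge0 j z (b : bool) : 0 <= a v z * bl j z * b%:R by rewrite !mulr_ge0.
have s1 : s (part x) != 0.
  rewrite gt_eqF //; rewrite /s (bigD1 x) //= vx eqxx Sx !mulr1.
  by rewrite ltr_pwDl // sumr_ge0.
have s2 : s (part y) != N0 / 2.
  rewrite sle ?adj_part // (bigD1 y) //= vy eqxx Sy !mulr1 lt_eqF //.
  by rewrite gtrBl ltr_pwDl // sumr_ge0.
have [/eqP|/eqP] := s_int _ (adj_part vx); first by rewrite (negbTE s1).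
by rewrite (s_eq _ _ vx vy) (negbTE s2).
Qed.

(** By [cut_star], membership of an edge in [S] depends on one endpoint only, hence is constant
    along edges of the connected graph. *)
Lemma strongly_connected x y u v : adj x y -> adj u v -> S x y = S u v.
Proof.
pose sg x := [exists y, adj x y && S x y].
have sgE x' y' : adj x' y' -> S x' y' = sg x'.
  move=> xy; apply/idP/existsP => [Sxy|[z /andP[xz Sxz]]]; first by exists y'; rewrite xy.
  by rewrite (cut_star xy xz).
have sgA x' y' : adj x' y' -> (sg x')%:R = (sg y')%:R :> R.
  by move=> xy; rewrite -(sgE _ _ xy) SC (sgE y') // adjC.
move=> xy uv; rewrite (sgE _ _ xy) (sgE _ _ uv).
have /eqP := connected_const mu0N sgA x u.
by rewrite eqr_nat; case: (sg x); case: (sg u).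
Qed.

End StrongConnectivity.

Lemma exists_nbr x : exists y, adj x y.
Proof.
apply/existsP; apply: contraT; rewrite negb_exists => /forallP h.
have /eqP := adj_deg x; rewrite big1 => [|y _]; last by rewrite (negbTE (h y)).
by rewrite eq_sym (gt_eqF N0_gt0).
Qed.

(** * The exceptional eigenspaces *)

Section Rigidity.
Hypotheses (mu0N : mu0 < N0) (mu1N : mu1 < N1).

Lemma triangle_sums0_const (psi : F0) :
  (forall x y z, tri x y z -> psi x + psi y + psi z = 0) ->
  forall x y, part x = part y -> psi x = psi y.
Proof.
move=> tri0 x0 y0 xy0; set i := part y0 in xy0.
(* [val x y] is the value of [psi] at the vertex of block [i] in any triangle on the edge [x y],
   hence is the same for all edges of a triangle. *)
pose val x y := if part x == i then psi x else if part y == i then psi y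
                else - (psi x + psi y).
pose S x y := adj x y && (val x y == psi x0).
have valC x y : adj x y -> val x y = val y x.
  move=> /adj_part xy; rewrite /val; case: (eqVneq (part x) i) xy => [->|_] xy.
    by rewrite eq_sym (negbTE xy).
  by case: (part y == i); rewrite // addrC.
have SC x y : S x y = S y x.
  by rewrite /S adjC; case: (boolP (adj y x)) => //= yx; rewrite (valC y x).
have S_tri x y z : tri x y z -> S x y = S x z.
  move=> txyz; have txzy : tri x z y by rewrite tri23.
  have [xy xz yz] := tri_parts txyz; have e := tri0 _ _ _ txyz.
  rewrite /S (tri_adj txyz) (tri_adj txzy) /= /val.
  case: (eqVneq (part x) i) => [//|xi].
  case: (eqVneq (part y) i) yz => [->|yi] yz.
    rewrite (eq_sym (part z)) (negbTE yz); congr (_ == _).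
    by rewrite -[LHS]subr0 -e; ring.
  have -> : part z == i.
    by apply/eqP; apply: (@ord3_third (part x) (part y)); rewrite // eq_sym.
  by congr (_ == _); rewrite -[RHS]subr0 -e; ring.
have [x1 x01] := exists_nbr x0; have [y1 y01] := exists_nbr y0.
have := strongly_connected mu0N mu1N SC S_tri x01 y01.
by rewrite /S /val x01 y01 /= xy0 eqxx /= eqxx => /esym/eqP ->.
Qed.

Lemma block_eigenspace_strong : block_eigenspace.
Proof.
move=> psi u _ Apsi bu; have psiC := triangle_sums0_const (triangle_sums0 Apsi).
pose c i := if [pick x | part x == i] is Some x then psi x else 0.
rewrite -(block_orthP c bu); apply: eq_bigr => x _; congr (_ * _).
by rewrite /c; case: pickP => [y /eqP/psiC->|/(_ x)]; rewrite ?eqxx.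
Qed.

(** For distinct blocks, the sign of the step from [i] to [j] in the cyclic order [0, 1, 2]; on the
    diagonal [-1] is a default. *)
Definition cyc (i j : 'I_3) : R := if (i.+1 %% 3 == j)%N then 1 else -1.

Lemma cycM i j : cyc i j * cyc i j = 1.
Proof. by rewrite /cyc; case: ifP => _; ring. Qed.

Lemma cycN i j : i != j -> cyc j i = - cyc i j.
Proof. by move: i j; do 2! case=> [[|[|[|?]]] ?] //=; rewrite /cyc /= ?opprK. Qed.

Lemma cyc_rot i j l : i != j -> i != l -> j != l -> cyc i j = cyc j l.
Proof. by move: i j l; do 3! case=> [[|[|[|?]]] ?]. Qed.

(** The form equal to [1] on edges oriented along the cyclic order of the blocks; it spans the
    eigenspace of [3 N1]. *)
Definition gamma : F1 := [ffun p => a p.1 p.2 * cyc (part p.1) (part p.2)].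

Lemma gammaE x y : gamma (x, y) = a x y * cyc (part x) (part y).
Proof. by rewrite ffunE. Qed.

Lemma gamma_Omega1 : Omega1 gamma.
Proof.
split=> x y; rewrite !gammaE; last by rewrite mulrA natr_boolM.
rewrite adjC; case: (boolP (adj x y)) => [/adj_part/cycN->|_]; last by rewrite !mul0r oppr0.
by rewrite mulrN.
Qed.

(** Every vertex has [N0 / 2] neighbours in the next block and as many in the previous one, with
    opposite signs. *)
Lemma gamma_bdy : bdy gamma = 0.
Proof.
apply/ffunP => y; rewrite ffunE [RHS]ffunE.
transitivity (\sum_i cyc i (part y) * \sum_x a y x * bl i x).
  under [RHS]eq_bigr do rewrite mulr_sumr.
  rewrite exchange_big; apply: eq_bigr => x _; rewrite gammaE adjC.
  rewrite (block_fun_expand (fun i => cyc i (part y))) mulr_sumr.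
  by apply: eq_bigr => i _; ring.
under eq_bigr do rewrite half_degree.
move: (part y) => j; rewrite !big_ord_recl big_ord0.
by move: j; case=> [[|[|[|?]]] ?] //=; rewrite /cyc /=; ring.
Qed.

Lemma gamma_Z1 : Z1 gamma.
Proof. by split; [exact: gamma_Omega1|exact: gamma_bdy]. Qed.

(** [gamma] is constant around a triangle, so [gamma (x, z)] and [gamma (z, y)] both equal
    [- gamma (x, y)]. *)
Lemma T1_gamma : T1 gamma = - (2 * N1) *: gamma.
Proof.
apply/ffunP => -[x y]; rewrite T1E ffZE gammaE.
transitivity (- 2 * cyc (part x) (part y) * (N1 * a x y)); last ring.
rewrite -tri_deg mulr_sumr; apply: eq_bigr => z _; rewrite !gammaE.
case: (boolP (tri x y z)) => [txyz|_]; last by rewrite !mul0r mulr0.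
have txzy : tri x z y by rewrite tri23.
have tzyx : tri z y x by rewrite tri13.
have [xy xz yz] := tri_parts txyz; have ns (i j : 'I_3) : i != j -> j != i by rewrite eq_sym.
rewrite (tri_adj txzy) (tri_adj tzyx) (cycN yz) -(cyc_rot xy xz yz).
rewrite (cycN (ns _ _ xz)) (cyc_rot (ns _ _ xz) (ns _ _ yz) xy) /=; ring.
Qed.

Lemma ip_gamma : ip gamma gamma = n * N0.
Proof.
rewrite ip_pair mulr_natl -sumr_const; apply: eq_bigr => x _.
rewrite -(adj_deg x); apply: eq_bigr => y _; rewrite gammaE.
transitivity (a x y * a x y * (cyc (part x) (part y) * cyc (part x) (part y))); first ring.
by rewrite natr_boolM cycM mulr1.
Qed.

(* [2 N1 + T1] is the sum over all triangles of the squared differences of the values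
   on consecutive edges, so an eigenvector for [- 2 N1] is constant around triangles. *)
Lemma T1_bottom_cyclic f : Omega1 f -> T1 f = - (2 * N1) *: f ->
  forall x y z, tri x y z -> f (x, y) = f (y, z).
Proof.
move=> [fs fa] Tf.
pose P x y z := t x y z * (f (x, y) * f (x, y)).
pose Q x y z := t x y z * (f (x, y) * f (y, z)).
have QE : \sum_x \sum_y \sum_z Q x y z = \sum_x \sum_y \sum_z t x y z * (f (x, y) * f (z, x)).
  rewrite (sum3_rot (fun x y z => t x y z * (f (x, y) * f (z, x)))).
  apply: eq_bigr => x _; apply: eq_bigr => y _; apply: eq_bigr => z _.
  by rewrite /Q (tri_rot x y z); ring.
have PQ : \sum_x \sum_y \sum_z P x y z = \sum_x \sum_y \sum_z Q x y z.
  have e1 : \sum_x \sum_y \sum_z P x y z = N1 * ip f f.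
    rewrite ip_pair mulr_sumr; apply: eq_bigr => x _; rewrite mulr_sumr; apply: eq_bigr => y _.
    by rewrite /P -mulr_suml tri_deg -{3}fa; ring.
  have e2 : - 2 * \sum_x \sum_y \sum_z Q x y z = ip f (T1 f).
    have -> : - 2 * \sum_x \sum_y \sum_z Q x y z = - \sum_x \sum_y \sum_z Q x y z -
       \sum_x \sum_y \sum_z t x y z * (f (x, y) * f (z, x)) by rewrite -QE; ring.
    rewrite ip_pair -opprD -big_split -sumrN; apply: eq_bigr => x _ /=.
    rewrite -big_split -sumrN; apply: eq_bigr => y _ /=; rewrite T1E -big_split -sumrN mulr_sumr.
    by apply: eq_bigr => z _ /=; rewrite /Q (fs z x) (fs y z) ; ring.
  by move: e2; rewrite Tf ipZr e1; lra.
have S0 : \sum_x \sum_y \sum_z t x y z * (f (x, y) - f (y, z)) ^+ 2 = 0.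
  transitivity (\sum_x \sum_y \sum_z P x y z + \sum_x \sum_y \sum_z P y z x
      - 2 * \sum_x \sum_y \sum_z Q x y z).
    rewrite mulr_sumr -big_split -sumrB; apply: eq_bigr => x _ /=.
    rewrite mulr_sumr -big_split -sumrB; apply: eq_bigr => y _ /=.
    rewrite mulr_sumr -big_split -sumrB; apply: eq_bigr => z _ /=.
    by rewrite /P /Q (tri_rot x y z); ring.
  by rewrite -(sum3_rot P) PQ; ring.
move=> x y z txyz; apply/eqP; rewrite -subr_eq0 -sqrf_eq0.
have term_ge0 u v w : 0 <= t u v w * (f (u, v) - f (v, w)) ^+ 2.
  by rewrite mulr_ge0 ?sqr_ge0.
have /eqP := S0; rewrite psumr_eq0 => [/allP/(_ x (mem_index_enum _))/=|u _]; last first.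
  by do 2! apply: sumr_ge0 => ? _.
rewrite psumr_eq0 => [/allP/(_ y (mem_index_enum _))/=|u _]; last exact: sumr_ge0.
rewrite psumr_eq0 // => /allP/(_ z (mem_index_enum _))/=.
by rewrite txyz mul1r.
Qed.

(** The product of [cyc] and [f] is symmetric, and constant on triangles by [T1_bottom_cyclic];
    strong connectivity makes it constant on all edges. *)
Lemma T1_bottom f : Omega1 f -> T1 f = - (2 * N1) *: f -> exists c, f = c *: gamma.
Proof.
move=> Of Tf; have cycf := T1_bottom_cyclic Of Tf; have [fs fa] := Of.
have /card_gt0P [x0 _] := V_gt0; have [y0 xy0] := exists_nbr x0.
pose g x y := cyc (part x) (part y) * f (x, y).
pose S x y := adj x y && (g x y == g x0 y0).
have gC x y : adj x y -> g x y = g y x.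
  by move=> /adj_part xy; rewrite /g (fs x y) (cycN xy); ring.
have SC x y : S x y = S y x.
  by rewrite /S adjC; case: (boolP (adj y x)) => //= yx; rewrite (gC y x).
have S_tri x y z : tri x y z -> S x y = S x z.
  move=> txyz; have txzy : tri x z y by rewrite tri23.
  have tyxz : tri y x z by rewrite tri12.
  have [yx yz xz] := tri_parts tyxz.
  rewrite /S (tri_adj txyz) (tri_adj txzy) /= gC ?(tri_adj txyz) //.
  by rewrite /g (cyc_rot yx yz xz) (cycf _ _ _ tyxz).
exists (g x0 y0); apply/ffunP => -[x y]; rewrite ffZE gammaE -fa.
case: (boolP (adj x y)) => [xy|_]; last by rewrite !mul0r mulr0.
have := strongly_connected mu0N mu1N SC S_tri xy xy0.
rewrite /S xy xy0 eqxx /= => /eqP <-; rewrite /g.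
transitivity (cyc (part x) (part y) * cyc (part x) (part y) * f (x, y)); last ring.
by rewrite cycM !mul1r.
Qed.

End Rigidity.

(** * Skew indicators of edge sets and links *)

Implicit Types A B : {set V}.

Lemma ind_disjoint A B x : [disjoint A & B] -> ind A x * ind B x = 0.
Proof.
move=> AB; case: (boolP (x \in A)) => [xA|_]; last by rewrite mul0r.
by rewrite (disjointFr AB xA) mulr0.
Qed.

Lemma ind_blocks A B i j x : i != j -> in_block A i -> in_block B j ->
  ind A x * ind B x = 0.
Proof.
move=> ij Ai Bj; rewrite -(ind_bl x Ai) -(ind_bl x Bj).
case: (eqVneq (part x) i) => [->|_]; last by rewrite !(mulr0, mul0r).
by rewrite (negbTE ij) !mulr0.
Qed.

Definition skew (A B : {set V}) : F1 :=
  [ffun p => a p.1 p.2 * (ind A p.1 * ind B p.2 - ind B p.1 * ind A p.2)].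

Definition link (A : {set V}) y z : R := \sum_x t y z x * ind A x.

Lemma skewE A B x y : skew A B (x, y) = a x y * (ind A x * ind B y - ind B x * ind A y).
Proof. by rewrite ffunE. Qed.

Lemma skew_Omega1 A B : Omega1 (skew A B).
Proof.
split=> x y; rewrite !skewE; first by rewrite adjC; ring.
by rewrite mulrA natr_boolM.
Qed.

Lemma sum2_sym (G : V -> V -> R) :
  \sum_x \sum_y (G x y + G y x) = 2 * \sum_x \sum_y G x y.
Proof.
transitivity (\sum_x \sum_y G x y + \sum_x \sum_y G y x).
  by rewrite -big_split; apply: eq_bigr => x _; rewrite big_split.
by rewrite [X in _ + X]exchange_big; ring.
Qed.

Lemma skew_ip A B : (forall x, ind A x * ind B x = 0) ->
  ip (skew A B) (skew A B) = 2 * edge_count A B.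
Proof.
move=> AB; rewrite ip_pair -sum2_sym; apply: eq_bigr => x _; apply: eq_bigr => y _.
rewrite skewE (adjC y x); move: (AB x) (AB y).
case: (adj x y); case: (x \in A); case: (x \in B); case: (y \in A); case: (y \in B);
  rewrite /= ?mulr1 ?mulr0 => // /eqP; rewrite ?oner_eq0 // => _ /eqP;
  rewrite ?oner_eq0 // => _; ring.
Qed.

Lemma skew_gamma A B i j : i != j -> in_block A i -> in_block B j -> cyc i j = 1 ->
  ip (skew A B) gamma = 2 * edge_count A B.
Proof.
move=> ij Ai Bj cij; rewrite ip_pair -sum2_sym; apply: eq_bigr => x _; apply: eq_bigr => y _.
rewrite skewE gammaE (adjC y x); case: (adj x y); last by rewrite /=; ring.
have e (u v : V) : ind A u * ind B v * cyc (part u) (part v) = ind A u * ind B v.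
  case: (boolP (u \in A)) => [/Ai->|_]; last by rewrite !mul0r.
  by case: (boolP (v \in B)) => [/Bj->|_]; rewrite ?cij ?mulr1 // mulr0 mul0r.
have e' : ind B x * ind A y * cyc (part x) (part y) = - (ind B x * ind A y).
  case: (boolP (y \in A)) => [/Ai->|_]; last by rewrite !mulr0 mul0r oppr0.
  case: (boolP (x \in B)) => [/Bj->|_]; last by rewrite !mul0r oppr0.
  by rewrite cycN // cij; ring.
rewrite /= !mul1r mulrBl e e'; ring.
Qed.

Lemma bdy_skew A B y : bdy (skew A B) y =
  ind B y * (\sum_x a x y * ind A x) - ind A y * (\sum_x a x y * ind B x).
Proof.
rewrite ffunE !mulr_sumr -sumrB; apply: eq_bigr => x _; rewrite skewE; ring.
Qed.

(** Each edge between [A] and [B] contributes [+1] on the block of [B] and [-1] on that of [A]. *)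
Lemma bdy_skew_block A B i j l : in_block A i -> in_block B j ->
  \sum_y bdy (skew A B) y * bl l y = edge_count A B * ((j == l)%:R - (i == l)%:R).
Proof.
move=> Ai Bj.
have blE (S : {set V}) k y : in_block S k -> ind S y * bl l y = ind S y * (k == l)%:R.
  by move=> Sk; case: (boolP (y \in S)) => [/Sk->|_]; rewrite ?mul0r.
transitivity (\sum_y \sum_x (ind B y * a y x * ind A x) * (j == l)%:R
   - \sum_y \sum_x (ind A y * a y x * ind B x) * (i == l)%:R).
  rewrite -sumrB; apply: eq_bigr => y _; rewrite bdy_skew mulrBl.
  rewrite ![_ * _ * bl l y]mulrAC (blE _ _ _ Ai) (blE _ _ _ Bj) !mulr_sumr -!sumrB.
  by apply: eq_bigr => x _; rewrite (adjC x y); ring.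
under eq_bigr do rewrite -mulr_suml; under [X in _ - X]eq_bigr do rewrite -mulr_suml.
by rewrite -!mulr_suml -!/(edge_count _ _) (edge_countC B A); ring.
Qed.

Lemma T1_skew A B y z : T1 (skew A B) (y, z) =
  ind A y * link B y z - ind B y * link A y z
  + link A y z * ind B z - link B y z * ind A z.
Proof.
rewrite T1E /link !mulr_sumr !mulr_suml -!sumrB -big_split -sumrB; apply: eq_bigr => x _ /=.
rewrite !skewE; case: (boolP (tri y z x)) => [tyzx|_]; last by rewrite /=; ring.
have tyxz : tri y x z by rewrite tri23.
have txzy : tri x z y by rewrite tri13.
by rewrite (tri_adj tyxz) (tri_adj txzy) /=; ring.
Qed.

(** All vertices completing an edge to a triangle lie in one block, the third one. *)
Lemma linkM A B i j y z : i != j -> in_block A i -> in_block B j ->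
  link A y z * link B y z = 0.
Proof.
move=> ij Ai Bj; rewrite /link mulr_suml big1 // => x _; rewrite mulr_sumr big1 // => x' _.
case: (boolP (x \in A)) => [/Ai xi|_]; last by rewrite mulr0 mul0r.
case: (boolP (x' \in B)) => [/Bj xj|_]; last by rewrite !mulr0.
case: (boolP (tri y z x)) => [h|_]; last by rewrite !mul0r.
case: (boolP (tri y z x')) => [h'|_]; last by rewrite mul0r mulr0.
have [yz yx zx] := tri_parts h; have [_ yx' zx'] := tri_parts h'.
have : part x' = part x by apply: (@ord3_third (part y) (part z)); rewrite // eq_sym.
by rewrite xi xj => ji; rewrite ji eqxx in ij.
Qed.

(** * Counting pairs of triangles spectrally *)

Section Count.
Variables (A B C D : {set V}).
Local Notation b0 := (@Ordinal 3 0 isT).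
Local Notation b1 := (@Ordinal 3 1 isT).
Local Notation b2 := (@Ordinal 3 2 isT).
(** With this numbering the steps from [A] to [B] and from [C] to [D] both follow the cyclic order,
    so both skew indicators pair with [gamma] positively. *)
Hypotheses (A0 : in_block A b0) (B1 : in_block B b1) (C2 : in_block C b2) (D0 : in_block D b0).
Hypothesis AD : [disjoint A & D].

Definition two_triangles : R :=
  \sum_y \sum_z ind B y * ind C z * (link A y z * link D y z).

Lemma indAB x : ind A x * ind B x = 0. Proof. exact: ind_blocks A0 B1. Qed.
Lemma indAC x : ind A x * ind C x = 0. Proof. exact: ind_blocks A0 C2. Qed.
Lemma indAD x : ind A x * ind D x = 0. Proof. exact: ind_disjoint. Qed.
Lemma indBC x : ind B x * ind C x = 0. Proof. exact: ind_blocks B1 C2. Qed.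
Lemma indBD x : ind B x * ind D x = 0. Proof. exact: ind_blocks B1 D0. Qed.
Lemma indCD x : ind C x * ind D x = 0. Proof. exact: ind_blocks C2 D0. Qed.

Lemma linkC S y z : link S z y = link S y z.
Proof. by apply: eq_bigr => x _; rewrite tri12. Qed.

(** Of the sixteen products, those with links of one edge into two blocks vanish by [linkM], and
    those with a vertex in both [B] and [C] vanish by disjointness. What remains is the count, once
    for each orientation of the shared edge. *)
Lemma T1_skew_skew : ip (T1 (skew A B)) (T1 (skew C D)) = 2 * two_triangles.
Proof.
rewrite ip_pair -sum2_sym; apply: eq_bigr => y _; apply: eq_bigr => z _.
rewrite !T1_skew !(linkC _ y z).
have lBC : link B y z * link C y z = 0 by exact: linkM B1 C2.
have lBD : link B y z * link D y z = 0 by exact: linkM B1 D0.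
have lAC : link A y z * link C y z = 0 by exact: linkM A0 C2.
move: (indAC y) (indAD y) (indBC y) (indBD y) (indAC z) (indAD z) (indBC z) (indBD z).
move: (link A y z) (link B y z) (link C y z) (link D y z) lBC lBD lAC => lA lB lC lD lBC lBD lAC.
move: (ind A y) (ind B y) (ind C y) (ind D y) (ind A z) (ind B z) (ind C z) (ind D z).
move=> Ay By Cy Dy Az Bz Cz Dz ACy ADy BCy BDy ACz ADz BCz BDz.
transitivity (By * Cz * (lA * lD) + Bz * Cy * (lA * lD)
  + (Ay * Cy) * (lB * lD) - (Ay * Dy) * (lB * lC) + (lB * lC) * (Ay * Dz) - (lB * lD) * (Ay * Cz)
  - (By * Cy) * (lA * lD) + (By * Dy) * (lA * lC) - (lA * lC) * (By * Dz)
  - (lA * lC) * (Bz * Dy) + (lA * lC) * (Bz * Dz) - (lA * lD) * (Bz * Cz)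
  - (lB * lD) * (Az * Cy) + (lB * lC) * (Az * Dy) - (lB * lC) * (Az * Dz) + (lB * lD) * (Az * Cz)).
  by ring.
by rewrite lBC lBD lAC BCy BCz; ring.
Qed.

(** An edge in the support of the first form has an end in [A] or [B], while one in the support of
    the second joins [C] and [D]; the four sets are disjoint. *)
Lemma T1_skew_orth : ip (T1 (skew A B)) (skew C D) = 0.
Proof.
rewrite ip_pair big1 // => y _; rewrite big1 // => z _; rewrite T1_skew skewE.
move: (indAC y) (indAD y) (indBC y) (indBD y) (indAC z) (indAD z) (indBC z) (indBD z).
move: (link A y z) (link B y z) => lA lB.
move: (ind A y) (ind B y) (ind C y) (ind D y) (ind A z) (ind B z) (ind C z) (ind D z).
move=> Ay By Cy Dy Az Bz Cz Dz ACy ADy BCy BDy ACz ADz BCz BDz.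
transitivity (a y z * (lB * Dz * (Ay * Cy) - lB * Cz * (Ay * Dy)
  - lA * Dz * (By * Cy) + lA * Cz * (By * Dy) + lA * Cy * (Bz * Dz) - lA * Dy * (Bz * Cz)
  - lB * Cy * (Az * Dz) + lB * Dy * (Az * Cz))); first by ring.
by rewrite ACy ADy BCy BDy ACz ADz BCz BDz; ring.
Qed.

(** The two boundaries live on the disjoint sets [A :|: B] and [C :|: D]. *)
Lemma bdy_skew_orth : ip (bdy (skew A B)) (bdy (skew C D)) = 0.
Proof.
rewrite /ip big1 // => y _; rewrite !bdy_skew.
move: (indAC y) (indAD y) (indBC y) (indBD y).
move: (\sum_x a x y * ind A x) (\sum_x a x y * ind B x).
move: (\sum_x a x y * ind C x) (\sum_x a x y * ind D x) => r s p q.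
move: (ind A y) (ind B y) (ind C y) (ind D y) => Ay By Cy Dy ACy ADy BCy BDy.
transitivity (p * r * (By * Dy) - p * s * (By * Cy) - q * r * (Ay * Dy) + q * s * (Ay * Cy)).
  by ring.
by rewrite ACy ADy BCy BDy; ring.
Qed.

Local Notation f := (skew A B).
Local Notation g := (skew C D).
Local Notation E := (edge_count A B).
Local Notation E' := (edge_count C D).
Local Notation Lap h := (N0 *: h - Adj h).

(* [PT] is the scalar [2 N1^2] on coboundaries and on [gamma], and small on the
   orthogonal complement of [gamma] in [Z1]. *)
Definition PT (h : F1) : F1 := T1 (T1 h) + N1 *: T1 h.

Lemma PT_linear : linear PT.
Proof.
move=> c h k; rewrite /PT [T1 (_ + k)]linearP [T1 (_ + T1 k)]linearP /=.
by rewrite [N1 *: (_ + _)]scalerDr [c *: (_ + _)]scalerDr !scalerA (mulrC c) addrACA.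
Qed.
HB.instance Definition _ := GRing.isLinear.Build R F1 F1 _ PT PT_linear.

Lemma ip_PT h k : ip (PT h) k = ip h (PT k).
Proof. by rewrite /PT ipDl ipDr ipZl ipZr !ip_T1. Qed.

Lemma PT_eigen h x : T1 h = x *: h -> PT h = (x * (x + N1)) *: h.
Proof. by move=> Th; rewrite /PT Th linearZ /= Th !scalerA -scalerDl; congr (_ *: _); ring. Qed.

Lemma PT_skew : ip (PT f) g = 2 * two_triangles.
Proof. by rewrite /PT ipDl ipZl ip_T1 T1_skew_skew T1_skew_orth mulr0 addr0. Qed.

(** If [x] is within [mu1] of [0] or of [- N1], one factor of [x (x + N1)] is at most [mu1] and the
    other at most [N1 + mu1] in absolute value. The third eigenvalue has only multiples of [gamma],
    to which [z] is orthogonal. *)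
Lemma PT_bound z : mu0 < N0 -> mu1 < N1 -> Z1 z -> ip z gamma = 0 ->
  ip (PT z) (PT z) <= ((N1 + mu1) * mu1) ^+ 2 * ip z z.
Proof.
move=> mu0N mu1N Zz zgamma; set c := (N1 + mu1) * mu1.
rewrite ip_PT -subr_ge0 -ipZr -ipBr.
apply: (@spectral_nonneg _ _ _ _ K1_sym Z1_subspace Z1_T1 _
  (fun h => c ^+ 2 *: h - PT (PT h)) (fun x => c ^+ 2 - (x * (x + N1)) ^+ 2)) => //.
- by move=> d h k; rewrite [PT (d *: h + k)]linearP [PT (d *: PT h + PT k)]linearP scalerDr
    scalerBr opprD addrACA !scalerA mulrC.
- by move=> x v Tv; rewrite (PT_eigen Tv) linearZ /= (PT_eigen Tv) scalerA scalerBl.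
move=> x v Zv Tv zv; have v0 := ip_neq0r zv.
have N1n : `|N1| = N1 by rewrite gtr0_norm.
suff key : `|x * (x + N1)| <= c.
  by rewrite subr_ge0 -[X in X <= _]real_normK ?num_real // lerXn2r ?nnegrE //= (le_trans _ key).
rewrite normrM /c; case: (spec1 Zv v0 Tv) => [h|h|h].
- rewrite mulrC; apply: ler_pM => //.
  by rewrite (le_trans (ler_normD _ _)) // N1n addrC lerD2l.
- apply: ler_pM => //; rewrite -[x in `|x|](addrK N1).
  by rewrite (le_trans (ler_normB _ _)) // N1n addrC lerD2l.
move: Tv; rewrite h => Tv; have [Ov _] := Zv.
have [d vE] := T1_bottom mu0N mu1N Ov Tv.
by move: zv; rewrite vE ipZr zgamma mulr0 eqxx.
Qed.

(** In the energy [<phi, Lap phi>], half the squared norm of [dl phi], the operator [Adj / N0]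
    contracts functions orthogonal to the block functions by [mu0 / N0]. *)
Lemma Lap_bound phi : mu0 < N0 -> block_eigenspace -> block_orth phi ->
  N0 ^- 2 * ip (Adj phi) (Lap (Adj phi)) <= (mu0 / N0) ^+ 2 * ip phi (Lap phi).
Proof.
move=> mu0N blk bphi; rewrite ip_Adj -subr_ge0 -!ipZr -ipBr.
apply: (@spectral_nonneg _ _ _ _ adj_sym_ker Z0_subspace Z0_Adj _
  (fun h => (mu0 / N0) ^+ 2 *: Lap h - N0 ^- 2 *: Adj (Lap (Adj h)))
  (fun x => (N0 - x) * N0 ^- 2 * (mu0 ^+ 2 - x ^+ 2))) => //.
- exact: block_orth_Z0.
- move=> d h k; apply/ffunP => x.
  have Lin u v : Lap (d *: u + v) = d *: Lap u + Lap v.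
    by rewrite [Adj _]linearP scalerDr scalerBr opprD addrACA !scalerA mulrC.
  by rewrite [Adj (_ *: h + k)]linearP !Lin [Adj (_ + _)]linearP !ffunE /GRing.scale /=; ring.
- move=> x v Av; have {Av}Av : Adj v = x *: v by [].
  have -> : Lap (Adj v) = (x * (N0 - x)) *: v.
    by rewrite Av [Adj (x *: v)]linearZ /= Av !scalerA -scalerBl; congr (_ *: _); ring.
  rewrite [Adj (_ *: v)]linearZ /= Av -[_ - x *: v]scalerBl !scalerA -scalerBl.
  by congr (_ *: _); field; exact: N0_neq0.
move=> x v Zv Av uv; case: (spec0 Zv (ip_neq0r uv) Av) => [h|h]; last first.
  by move: uv; rewrite blk ?eqxx // -h.
rewrite !mulr_ge0 ?invr_ge0 ?exprn_ge0 ?N0_ge0 //.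
  by rewrite subr_ge0 (le_trans (ler_normlW h)) // ltW.
by rewrite subr_ge0 -[x ^+ 2]real_normK ?num_real // lerXn2r ?nnegrE.
Qed.

Lemma dl_norm phi : ip (dl phi) (dl phi) = 2 * ip phi (Lap phi).
Proof. by rewrite ip_dl ?bdy_dl //; exact: dl_Omega1. Qed.

Lemma Adj_block_sum (phi : F0) i :
  \sum_x Adj phi x * bl i x = N0 / 2 * (\sum_x phi x - \sum_x phi x * bl i x).
Proof.
transitivity (\sum_y phi y * \sum_x a y x * bl i x).
  under [RHS]eq_bigr do rewrite mulr_sumr.
  rewrite exchange_big; apply: eq_bigr => x _; rewrite AdjE mulr_suml.
  by apply: eq_bigr => y _; rewrite (adjC y x) /=; ring.
rewrite -sumrB mulr_sumr; apply: eq_bigr => y _; rewrite half_degree.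
by case: (part y == i) => /=; ring.
Qed.

Lemma main_estimate : mu0 < N0 -> mu1 < N1 ->
  `|two_triangles - 6 * N1 ^+ 2 / (n * N0) * (E * E')|
  <= (2 * N1 ^+ 2 * mu0 / N0 + (N1 + mu1) * mu1) * Num.sqrt (E * E').
Proof.
move=> mu0N mu1N; have blk := block_eigenspace_strong mu0N mu1N.
have nN0 := n_neq0; have N0N0 := N0_neq0.
have Of : Omega1 f := skew_Omega1 A B; have Og : Omega1 g := skew_Omega1 C D.
have fgamma : ip f gamma = 2 * E by exact: skew_gamma A0 B1 _.
have ggamma : ip g gamma = 2 * E' by exact: skew_gamma C2 D0 _.
have ff : ip f f = 2 * E by apply: skew_ip; exact: indAB.
have gg : ip g g = 2 * E' by apply: skew_ip; exact: indCD.
have [phi Zphi bz] := hodge mu0N Of.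
(* The coefficient of [gamma] in [f] is [<f, gamma> / <gamma, gamma>]; together with the coboundary
   part it leaves [z] in [Z1], orthogonal to [gamma]. *)
pose cst := 2 * E / (n * N0); pose z := f - dl phi - cst *: gamma.
have dlgamma h : ip (dl h) gamma = 0 by rewrite ip_dl ?gamma_bdy ?ip0r ?mulr0 //;
  exact: gamma_Omega1.
have Zz : Z1 z.
  apply: subspaceB Z1_subspace _ _ _ (subspaceZ Z1_subspace _ gamma_Z1); split=> //.
  exact: subspaceB Omega1_subspace _ _ Of (dl_Omega1 phi).
have zgamma : ip z gamma = 0.
  rewrite /z !ipBl ipZl fgamma dlgamma ip_gamma /cst; field.
  by rewrite nN0 N0N0.
have fE : f = dl phi + cst *: gamma + z by rewrite /z -(addrA f) -opprD [RHS]addrC subrK.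
clearbody z.
have dlz : ip (dl phi) z = 0 by case: Zz => Oz bz'; rewrite ip_dl // bz' ip0r mulr0.
(* Pythagoras: the three parts of [f] are mutually orthogonal. *)
have zz : ip z z <= 2 * E.
  rewrite -ff [in X in _ <= X]fE !(ipDl, ipDr, ipZl, ipZr) (ipC gamma (dl phi)) dlgamma.
  rewrite (ipC gamma z) zgamma (ipC z (dl phi)) dlz !mulr0 !addr0 !add0r mulrA -expr2.
  by rewrite lerDr addr_ge0 ?ip_ge0 // mulr_ge0 ?sqr_ge0 ?ip_ge0.
have E_ge0 := edge_count_ge0 A B; have E'_ge0 := edge_count_ge0 C D.
have sqrtEE : Num.sqrt (2 * E) * Num.sqrt (2 * E') = 2 * Num.sqrt (E * E').
  rewrite -sqrtrM ?mulr_ge0 // (_ : 2 * E * (2 * E') = 2 ^+ 2 * (E * E')); last by ring.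
  by rewrite sqrtrM ?sqr_ge0 // sqrtr_sqr ger0_norm.
have r1 : `|ip (PT z) g| <= 2 * ((N1 + mu1) * mu1 * Num.sqrt (E * E')).
  have c_ge0 : 0 <= (N1 + mu1) * mu1 by rewrite mulr_ge0 // addr_ge0 // ltW.
  apply: le_trans (cauchy_schwarz _ _) _.
  rewrite gg mulrCA -sqrtEE mulrA ler_wpM2r ?sqrtr_ge0 //.
  rewrite -[(N1 + mu1) * mu1](ger0_norm c_ge0) -sqrtr_sqr -sqrtrM ?sqr_ge0 //.
  apply: ler_wsqrtr; apply: le_trans (PT_bound mu0N mu1N Zz zgamma) _.
  by rewrite ler_wpM2l ?sqr_ge0.
have [al alE] : exists al, al = 3 * E / n by eexists.
(* The projection of [bdy f] to block functions: the totals [E] and [- E] on the blocks of [B] and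
   [A], spread over [n / 3] vertices each. *)
pose om : F0 := [ffun x => al * (bl b1 x - bl b0 x)].
have om_block l : \sum_x om x * bl l x = E * ((b1 == l)%:R - (b0 == l)%:R).
  transitivity (al * ((b1 == l)%:R * \sum_x bl b1 x - (b0 == l)%:R * \sum_x bl b0 x)).
    rewrite mulrBr !mulr_sumr -sumrB; apply: eq_bigr => x _; rewrite ffunE.
    case: (eqVneq (part x) l) => [->|xl].
      by rewrite !(eq_sym l); case: (b1 == l); case: (b0 == l) => /=; ring.
    case: (eqVneq (part x) b1) xl => [->|xb1] xl; first by rewrite (negbTE xl) /=; ring.
    case: (eqVneq (part x) b0) xl => [->|xb0] xl; first by rewrite (negbTE xl) /=; ring.
    by rewrite /=; ring.
  by rewrite !block_size alE; field.
have Zom : Z0 om.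
  by rewrite /Z0 sum_blE; under eq_bigr do rewrite om_block; rewrite !big_ord_recl big_ord0 /=;
    ring.
have Aom : Adj om = - (N0 / 2) *: om.
  apply/ffunP => x; rewrite AdjE ffZE ffunE.
  transitivity (al * (\sum_y a x y * bl b1 y - \sum_y a x y * bl b0 y)).
    rewrite -sumrB mulr_sumr; apply: eq_bigr => y _; rewrite ffunE; ring.
  by rewrite !half_degree; case: (part x == b1); case: (part x == b0) => /=; ring.
pose w := bdy f - om.
have bw : block_orth w.
  move=> l; transitivity (\sum_x bdy f x * bl l x - \sum_x om x * bl l x).
    by rewrite -sumrB; apply: eq_bigr => x _; rewrite ffBE mulrBl.
  by rewrite om_block (bdy_skew_block _ A0 B1) subrr.
have Lphi : Lap phi = bdy f.
  by apply/eqP; rewrite -bdy_dl eq_sym -subr_eq0 -linearB /= bz.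
(* [Lap om] is [3 N0 / 2] times [om], so this subtraction removes [om] from the right hand side of
   [Lap phi = bdy f]. *)
pose phi' := phi - (2 / (3 * N0)) *: om.
have Lphi' : Lap phi' = w.
  have Aphi' : Adj phi' = Adj phi - (2 / (3 * N0)) *: Adj om by rewrite linearB linearZ.
  rewrite /w -Lphi; apply/ffunP => x; rewrite Aphi' Aom !(ffBE, ffZE).
  by field.
have Zphi' : Z0 phi' by apply: subspaceB Z0_subspace _ _ Zphi (subspaceZ Z0_subspace _ Zom).
(* On block sums of functions in [Z0], [Adj] acts as [- N0 / 2], hence [Lap] as the invertible
   scalar [3 N0 / 2]. *)
have bphi' : block_orth phi'.
  move=> i; have := bw i; rewrite -Lphi'.
  have -> : \sum_x Lap phi' x * bl i x
      = N0 * (\sum_x phi' x * bl i x) - \sum_x Adj phi' x * bl i x.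
    by rewrite mulr_sumr -sumrB; apply: eq_bigr => x _; rewrite ffBE ffZE mulrBl mulrA.
  rewrite Adj_block_sum Zphi' sub0r => h.
  have /eqP : 3 / 2 * N0 * \sum_x phi' x * bl i x = 0 by rewrite -[RHS]h; field.
  by rewrite !mulf_eq0 (negbTE N0N0) invr_eq0 !pnatr_eq0 /= => /eqP.
have omE h : ip om h = al * (\sum_x h x * bl b1 x - \sum_x h x * bl b0 x).
  rewrite -sumrB mulr_sumr; apply: eq_bigr => x _; rewrite ffunE; ring.
have omg : ip om (bdy g) = - (3 * E * E' / n).
  by rewrite omE !(bdy_skew_block _ C2 D0) alE /=; field.
(* [dl phi'] is an orthogonal projection of [f], since its pairing with [f] is its own squared
   norm. *)
have X_le : ip (dl phi') (dl phi') <= 2 * E.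
  have Xf : ip (dl phi') f = ip (dl phi') (dl phi').
    rewrite dl_norm Lphi' ip_dl // /w ipBr (ipC phi' om) omE !bphi'.
    by rewrite subrr mulr0 subr0.
  have := ip_ge0 (f - dl phi'); rewrite !(ipBl, ipBr) (ipC f (dl phi')) Xf ff.
  by rewrite subrr subr0 subr_ge0.
(* [Lap phi' = w] splits [phi'] into [w / N0], whose pairing with [bdy g] is explicit, and the part
   [psi] of relative size [mu0 / N0]. *)
pose psi := N0^-1 *: Adj phi'.
have psiE : phi' = psi + N0^-1 *: w.
  by rewrite /psi -Lphi' -scalerDr addrC subrK scalerA mulVf // scale1r.
have r2 : `|ip psi (bdy g)| <= mu0 / N0 * Num.sqrt (E * E').
  have -> : ip psi (bdy g) = ip (dl psi) g / 2 by rewrite ip_dl //; field.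
  rewrite normrM normfV [`|2|]ger0_norm // ler_pdivrMr //.
  rewrite [X in _ <= X](_ : _ = mu0 / N0 * (2 * Num.sqrt (E * E'))); last by ring.
  rewrite -sqrtEE.
  apply: le_trans (cauchy_schwarz _ _) _; rewrite gg mulrA ler_wpM2r ?sqrtr_ge0 //.
  have m_ge0 : 0 <= mu0 / N0 by rewrite divr_ge0 ?N0_ge0.
  rewrite -[mu0 / N0](ger0_norm m_ge0) -sqrtr_sqr -sqrtrM ?sqr_ge0 //; apply: ler_wsqrtr.
  have := Lap_bound mu0N blk bphi'; move: X_le; rewrite !dl_norm.
  have -> : ip psi (Lap psi) = N0 ^- 2 * ip (Adj phi') (Lap (Adj phi')).
    rewrite /psi [Adj (_ *: _)]linearZ /= scalerA (mulrC N0) -scalerA -scalerBr ipZl ipZr.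
    by rewrite mulrA -expr2 exprVn.
  set X := ip phi' _; set Y := _ * ip _ _ => X_le Y_le.
  apply: (@le_trans _ _ (2 * ((mu0 / N0) ^+ 2 * X))); first by rewrite ler_pM2l.
  by rewrite mulrCA ler_wpM2l ?sqr_ge0.
have PTdl : PT (dl phi) = (2 * N1 ^+ 2) *: dl phi.
  by rewrite (PT_eigen (T1_dl phi)); congr (_ *: _); ring.
have PTgamma : PT gamma = (2 * N1 ^+ 2) *: gamma.
  by rewrite (PT_eigen T1_gamma); congr (_ *: _); ring.
have PTf : PT f = (2 * N1 ^+ 2) *: dl phi + cst *: ((2 * N1 ^+ 2) *: gamma) + PT z.
  by rewrite [in LHS]fE !linearD linearZ /= PTdl PTgamma.
have F2 : 2 * two_triangles
    = 2 * N1 ^+ 2 * (2 * ip phi (bdy g)) + cst * (2 * N1 ^+ 2 * (2 * E')) + ip (PT z) g.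
  by rewrite -PT_skew PTf !ipDl !ipZl (ip_dl _ Og) (ipC gamma g) ggamma.
(* As [<bdy f, bdy g> = 0], [w / N0] contributes [3 E E' / (n N0)], and the multiple of [om]
   contributes [- 2 E E' / (n N0)]. *)
have phig : ip phi (bdy g) = E * E' / (n * N0) + ip psi (bdy g).
  have -> : phi = psi + N0^-1 *: w + (2 / (3 * N0)) *: om by rewrite -psiE /phi' subrK.
  rewrite !ipDl !ipZl /w ipBl bdy_skew_orth omg; field.
  by rewrite nN0 N0N0.
(* The coboundary contributes [2 N1^2 E E' / (n N0)] and [gamma] twice as much, hence the constant
   [6]. *)
have FE : two_triangles - 6 * N1 ^+ 2 / (n * N0) * (E * E')
    = 2 * N1 ^+ 2 * ip psi (bdy g) + ip (PT z) g / 2.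
  rewrite -[two_triangles](mulKf (_ : 2 != 0)) ?pnatr_eq0 // F2 phig /cst; field.
  by rewrite nN0 N0N0.
rewrite FE; apply: le_trans (ler_normD _ _) _; rewrite [leRHS]mulrDl; apply: lerD.
  have k_ge0 : 0 <= 2 * N1 ^+ 2 by rewrite mulr_ge0 ?sqr_ge0.
  rewrite normrM (ger0_norm k_ge0).
  rewrite [leRHS](_ : _ = 2 * N1 ^+ 2 * (mu0 / N0 * Num.sqrt (E * E'))); last by ring.
  exact: ler_wpM2l.
by rewrite normrM normfV [`|2|]ger0_norm // ler_pdivrMr // mulrC.
Qed.

(** * Crude bounds and the final estimate *)

Lemma link_ge0 S y z : 0 <= link S y z.
Proof. by apply: sumr_ge0 => x _; rewrite mulr_ge0. Qed.

Lemma link_le S y z : link S y z <= N1.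
Proof.
apply: (@le_trans _ _ (N1 * a y z)); last by rewrite ler_piMr ?lern1 ?leq_b1 // ltW.
by rewrite -tri_deg; apply: ler_sum => x _; rewrite ler_piMr ?lern1 ?leq_b1.
Qed.

(** One factor [link] is bounded by [N1]; the other, summed, counts triangles over edges from [S] to
    [T], with [N1] for each edge. *)
Lemma link_sqr_sum (S T : {set V}) :
  \sum_y \sum_z ind S y * link T y z ^+ 2 <= N1 ^+ 2 * edge_count S T.
Proof.
have -> : N1 ^+ 2 * edge_count S T = \sum_y \sum_z ind S y * (N1 * link T y z).
  rewrite /edge_count mulr_sumr; apply: eq_bigr => y _; rewrite mulr_sumr.
  transitivity (\sum_x N1 * (ind S y * ind T x) * \sum_z t y x z).
    by apply: eq_bigr => x _; rewrite tri_deg; ring.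
  under eq_bigr do rewrite mulr_sumr; rewrite exchange_big; apply: eq_bigr => z _ /=.
  by rewrite !mulr_sumr; apply: eq_bigr => x _; rewrite tri23; ring.
apply: ler_sum => y _; apply: ler_sum => z _.
by rewrite ler_wpM2l // expr2 ler_wpM2r ?link_ge0 ?link_le.
Qed.

(** Cauchy-Schwarz over the shared edge, then [link_sqr_sum] for either triangle. *)
Lemma two_triangles_le : two_triangles <= N1 ^+ 2 * Num.sqrt (E * E').
Proof.
pose u : F1 := [ffun p => ind B p.1 * link A p.1 p.2].
pose v : F1 := [ffun p => ind C p.2 * link D p.1 p.2].
have -> : two_triangles = ip u v.
  rewrite ip_pair; apply: eq_bigr => y _; apply: eq_bigr => z _; rewrite !ffunE /=; ring.
have uu : ip u u <= N1 ^+ 2 * E.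
  rewrite (edge_countC A B); apply: le_trans (link_sqr_sum B A); rewrite ip_pair le_eqVlt.
  apply/orP; left; apply/eqP; apply: eq_bigr => y _; apply: eq_bigr => z _; rewrite ffunE /=.
  by case: (y \in B) => /=; ring.
have vv : ip v v <= N1 ^+ 2 * E'.
  apply: le_trans (link_sqr_sum C D); rewrite ip_pair exchange_big le_eqVlt.
  apply/orP; left; apply/eqP; apply: eq_bigr => y _; apply: eq_bigr => z _; rewrite ffunE /=.
  by rewrite (linkC D y z); case: (y \in C) => /=; ring.
apply: le_trans (ler_norm _) _; apply: le_trans (cauchy_schwarz _ _) _.
have -> : N1 ^+ 2 * Num.sqrt (E * E') = Num.sqrt (N1 ^+ 2 * E) * Num.sqrt (N1 ^+ 2 * E').
  rewrite (sqrtrM E (sqr_ge0 N1)) (sqrtrM E' (sqr_ge0 N1)) (sqrtrM E' (edge_count_ge0 A B)).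
  by rewrite sqrtr_sqr (gtr0_norm N1_gt0); ring.
by apply: ler_pM; rewrite ?sqrtr_ge0 // ler_wsqrtr.
Qed.

Lemma card_block (S : {set V}) i : in_block S i -> #|S|%:R <= n / 3.
Proof.
move=> Si; rewrite -(block_size i) -sum_ind; apply: ler_sum => x _.
by case: (boolP (x \in S)) => // /Si ->; rewrite eqxx.
Qed.

Lemma sqrt_card_block (S T : {set V}) i j : in_block S i -> in_block T j ->
  Num.sqrt (#|S|%:R * #|T|%:R) <= n / 3.
Proof.
move=> Si Tj; have n3 : 0 <= n / 3 by rewrite divr_ge0.
rewrite -(ger0_norm n3) -sqrtr_sqr ler_wsqrtr // expr2.
by apply: ler_pM; rewrite ?ler0n ?(card_block Si) ?(card_block Tj).
Qed.

(* When [mu0 >= N0 / 4] the degree bound suffices; otherwise mixing applies. *)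
Lemma edge_count_le2 (S T : {set V}) i j : i != j -> in_block S i -> in_block T j ->
  edge_count S T <= 2 * (Num.sqrt (#|S|%:R * #|T|%:R)
    * (3 * N0 * Num.sqrt (#|S|%:R * #|T|%:R) / (2 * n) + mu0)).
Proof.
move=> ij Si Tj; set s := Num.sqrt _; have s_ge0 : 0 <= s by exact: sqrtr_ge0.
have n_gt := n_gt0.
have s2 : s * s = #|S|%:R * #|T|%:R by rewrite -expr2 sqr_sqrtr // mulr_ge0.
have q_ge0 : 0 <= 3 * N0 * s / (2 * n) by rewrite divr_ge0 ?mulr_ge0 ?N0_ge0 // ltW.
have [small|big] := ltP mu0 (N0 / 4).
  have := mixing (block_eigenspace_small small) ij Si Tj; rewrite -/s => /ler_normlW.
  have -> : 3 * N0 * #|S|%:R * #|T|%:R / (2 * n) = s * (3 * N0 * s / (2 * n)).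
    by rewrite -(mulrA (3 * N0)) -s2; ring.
  have : 0 <= s * (3 * N0 * s / (2 * n)) by rewrite mulr_ge0.
  have : 0 <= s * mu0 by rewrite mulr_ge0.
  rewrite mulrDr (mulrC mu0); lra.
apply: le_trans (edge_count_le Si Tj) _; rewrite -/s.
have h1 : s * (N0 / 4) <= s * mu0 by rewrite ler_wpM2l.
have : 0 <= s * (3 * N0 * s / (2 * n)) by rewrite mulr_ge0.
rewrite mulrDr; lra.
Qed.

Local Notation al := (GRing.natmul (GRing.one R) #|A|).
Local Notation be := (GRing.natmul (GRing.one R) #|B|).
Local Notation ce := (GRing.natmul (GRing.one R) #|C|).
Local Notation de := (GRing.natmul (GRing.one R) #|D|).

Theorem tripartite_mixing :
  `|two_triangles - 27 * N0 * N1 ^+ 2 * al * be * ce * de / (2 * n ^+ 3)|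
  <= 6 * mu0 * N1 ^+ 2 * Num.sqrt (al * be * ce * de) / (N0 * n)
       * (3 * N0 * (Num.sqrt (al * be) + Num.sqrt (ce * de)) / (2 * n) + mu0)
     + (2 * N1 ^+ 2 * mu0 / N0 + (N1 + mu1) * mu1)
       * Num.sqrt (Num.sqrt (al * be * ce * de))
       * Num.sqrt ((3 * N0 * Num.sqrt (al * be) / (2 * n) + mu0)
                   * (3 * N0 * Num.sqrt (ce * de) / (2 * n) + mu0)).
Proof.
have n_gt := n_gt0; have nN0 := n_neq0; have N0N0 := N0_neq0.
have N0n := N0_ge0; have N1n := ltW N1_gt0.
set s1 := Num.sqrt (al * be); set s2 := Num.sqrt (ce * de).
have s1_ge0 : 0 <= s1 by exact: sqrtr_ge0.
have s2_ge0 : 0 <= s2 by exact: sqrtr_ge0.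
have s1s1 : s1 * s1 = al * be by rewrite -expr2 sqr_sqrtr // mulr_ge0 ?ler0n.
have s2s2 : s2 * s2 = ce * de by rewrite -expr2 sqr_sqrtr // mulr_ge0 ?ler0n.
have -> : Num.sqrt (al * be * ce * de) = s1 * s2.
  by rewrite -(mulrA (al * be)) sqrtrM // mulr_ge0 ?ler0n.
(* [k s1^2] and [k s2^2] are the expected edge counts; adding the mixing errors [mu0 s1] and
   [mu0 s2] gives [M1] and [M2] below. *)
have [k kE] : exists k, k = 3 * N0 / (2 * n) by eexists.
have k_ge0 : 0 <= k by rewrite kE divr_ge0 ?mulr_ge0 // ltW.
have -> : 3 * N0 * s1 / (2 * n) = k * s1 by rewrite kE; field.
have -> : 3 * N0 * s2 / (2 * n) = k * s2 by rewrite kE; field.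
have -> : 3 * N0 * (s1 + s2) / (2 * n) = k * (s1 + s2) by rewrite kE; field.
have [c cE] : exists c, c = 6 * N1 ^+ 2 / (n * N0) by eexists.
have c_ge0 : 0 <= c by rewrite cE divr_ge0 ?mulr_ge0 ?sqr_ge0 // ltW.
have -> : 27 * N0 * N1 ^+ 2 * al * be * ce * de / (2 * n ^+ 3) = c * (k * (s1 * s1) * (k * (s2 *
  s2))).
  by rewrite s1s1 s2s2 cE kE; field; rewrite nN0 N0N0.
pose M1 := s1 * (k * s1 + mu0); pose M2 := s2 * (k * s2 + mu0).
have X1_ge0 : 0 <= k * s1 + mu0 by rewrite addr_ge0 // mulr_ge0.
have X2_ge0 : 0 <= k * s2 + mu0 by rewrite addr_ge0 // mulr_ge0.
have M1_ge0 : 0 <= M1 by rewrite mulr_ge0.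
have M2_ge0 : 0 <= M2 by rewrite mulr_ge0.
have -> : (2 * N1 ^+ 2 * mu0 / N0 + (N1 + mu1) * mu1) * Num.sqrt (s1 * s2)
    * Num.sqrt ((k * s1 + mu0) * (k * s2 + mu0))
    = (2 * N1 ^+ 2 * mu0 / N0 + (N1 + mu1) * mu1) * Num.sqrt (M1 * M2).
  rewrite -[LHS]mulrA -(sqrtrM _ (mulr_ge0 s1_ge0 s2_ge0)); congr (_ * Num.sqrt _).
  by rewrite /M1 /M2; ring.
set K := 2 * N1 ^+ 2 * mu0 / N0 + (N1 + mu1) * mu1.
have r1_ge0 : 0 <= 6 * mu0 * N1 ^+ 2 * (s1 * s2) / (N0 * n) * (k * (s1 + s2) + mu0).
  rewrite !mulr_ge0 ?sqr_ge0 ?addr_ge0 ?invr_ge0 ?mulr_ge0 ?mulr_ge0 ?addr_ge0 ?ler0n //.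
have [/andP[mu0N mu1N]|big] := boolP ((mu0 < N0) && (mu1 < N1)).
  have blk := block_eigenspace_strong mu0N mu1N.
  have d1 : `|E - k * (s1 * s1)| <= mu0 * s1.
    have := mixing blk (isT : b0 != b1) A0 B1; rewrite -/s1.
    by rewrite (_ : 3 * N0 * al * be / (2 * n) = k * (s1 * s1)) // s1s1 kE; field.
  have d2 : `|E' - k * (s2 * s2)| <= mu0 * s2.
    have := mixing blk (isT : b2 != b0) C2 D0; rewrite -/s2.
    by rewrite (_ : 3 * N0 * ce * de / (2 * n) = k * (s2 * s2)) // s2s2 kE; field.
  have E_ge0 := edge_count_ge0 A B; have E'_ge0 := edge_count_ge0 C D.
  have E_le : E <= M1.
    by rewrite -[E](subrK (k * (s1 * s1))) (_ : M1 = mu0 * s1 + k * (s1 * s1)) ?lerD2r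
      ?(ler_normlW d1) // /M1; ring.
  have E'_le : E' <= M2.
    by rewrite -[E'](subrK (k * (s2 * s2))) (_ : M2 = mu0 * s2 + k * (s2 * s2)) ?lerD2r
      ?(ler_normlW d2) // /M2; ring.
  have main := main_estimate mu0N mu1N; rewrite -cE in main.
  have K_ge0 : 0 <= K by rewrite addr_ge0 ?divr_ge0 ?mulr_ge0 ?addr_ge0 ?sqr_ge0 // ltW.
  have EE : `|E * E' - k * (s1 * s1) * (k * (s2 * s2))| <= mu0 * (s1 * s2) * (k * (s1 + s2) + mu0).
    have -> : E * E' - k * (s1 * s1) * (k * (s2 * s2)) =
      (E - k * (s1 * s1)) * (E' - k * (s2 * s2)) + k * (s1 * s1) * (E' - k * (s2 * s2))
      + k * (s2 * s2) * (E - k * (s1 * s1)) by ring.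
    apply: (@le_trans _ _ (mu0 * s1 * (mu0 * s2) + k * (s1 * s1) * (mu0 * s2)
        + k * (s2 * s2) * (mu0 * s1))); last by rewrite le_eqVlt; apply/orP; left; apply/eqP; ring.
    have n1 : 0 <= k * (s1 * s1) by rewrite !mulr_ge0.
    have n2 : 0 <= k * (s2 * s2) by rewrite !mulr_ge0.
    apply: le_trans (ler_normD _ _) _; apply: lerD.
      apply: le_trans (ler_normD _ _) _; apply: lerD; first by rewrite normrM ler_pM.
      by rewrite normrM (ger0_norm n1) ler_wpM2l.
    by rewrite normrM (ger0_norm n2) ler_wpM2l.
  rewrite -[two_triangles](subrK (c * (E * E'))) -addrA -mulrBr addrC.
  apply: le_trans (ler_normD _ _) _; apply: lerD.
    rewrite normrM (ger0_norm c_ge0); apply: le_trans (ler_wpM2l c_ge0 EE) _.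
    by rewrite le_eqVlt; apply/orP; left; apply/eqP; rewrite cE; field; rewrite nN0 N0N0.
  by apply: le_trans main _; rewrite ler_wpM2l // ler_wsqrtr // ler_pM.
(* If [mu0 >= N0] the first summand of [K] is at least [2 N1^2]; if [mu1 >= N1] the second one
   is. *)
have K_ge : 2 * N1 ^+ 2 <= K.
  have p1 : 0 <= 2 * N1 ^+ 2 * mu0 / N0 by rewrite divr_ge0 ?mulr_ge0 ?sqr_ge0 // ltW.
  have p2 : 0 <= (N1 + mu1) * mu1 by rewrite mulr_ge0 ?addr_ge0 // ltW.
  move: big; rewrite negb_and -!leNgt => /orP[big|big].
    rewrite -[leLHS]addr0 lerD // ler_pdivlMr // ler_wpM2l ?mulr_ge0 ?sqr_ge0 //.
  rewrite -[leLHS]add0r lerD // (_ : 2 * N1 ^+ 2 = (N1 + N1) * N1); last by ring.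
  by rewrite ler_pM ?addr_ge0 ?lerD2l // ltW.
set Z := Num.sqrt (M1 * M2).
have Z_ge0 : 0 <= Z by exact: sqrtr_ge0.
(* It suffices that the count and the main term both lie between [0] and [2 N1^2 Z]. *)
apply: (@le_trans _ _ (2 * N1 ^+ 2 * Z)); last first.
  by rewrite -[leLHS]add0r lerD // ler_wpM2r.
have F_ge0 : 0 <= two_triangles.
  by do 2! apply: sumr_ge0 => ? _; rewrite !mulr_ge0 ?link_ge0.
have F_le : two_triangles <= 2 * N1 ^+ 2 * Z.
  apply: le_trans two_triangles_le _.
  rewrite (_ : 2 * N1 ^+ 2 * Z = N1 ^+ 2 * (2 * Z)); last by ring.
  apply: ler_wpM2l; first exact: sqr_ge0.
  have -> : 2 * Z = Num.sqrt (2 * M1 * (2 * M2)).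
    rewrite (_ : 2 * M1 * (2 * M2) = 2 ^+ 2 * (M1 * M2)); last by ring.
    by rewrite (sqrtrM _ (sqr_ge0 2)) sqrtr_sqr ger0_norm.
  apply: ler_wsqrtr; apply: ler_pM; rewrite ?edge_count_ge0 //.
    have := edge_count_le2 (isT : b0 != b1) A0 B1; rewrite -/s1.
    by rewrite (_ : 3 * N0 * s1 / _ = k * s1) // kE; field.
  have := edge_count_le2 (isT : b2 != b0) C2 D0; rewrite -/s2.
  by rewrite (_ : 3 * N0 * s2 / _ = k * s2) // kE; field.
have m_ge0 : 0 <= c * (k * (s1 * s1) * (k * (s2 * s2))) by rewrite !mulr_ge0.
(* [s1] and [s2] are at most [n / 3], which bounds [c k s1 s2] by [N1^2]; the remaining factor
   [k s1 s2] is at most [Z]. *)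
have m_le : c * (k * (s1 * s1) * (k * (s2 * s2))) <= 2 * N1 ^+ 2 * Z.
  have ck : c * (k * (s1 * s2)) <= 2 * N1 ^+ 2.
    have ss : s1 * s2 <= n / 3 * (n / 3).
      by apply: ler_pM => //; [exact: sqrt_card_block A0 B1|exact: sqrt_card_block C2 D0].
    rewrite (_ : c * (k * (s1 * s2)) = 9 * N1 ^+ 2 / n ^+ 2 * (s1 * s2)); last first.
      by rewrite cE kE; field; rewrite nN0 N0N0.
    apply: (@le_trans _ _ (9 * N1 ^+ 2 / n ^+ 2 * (n / 3 * (n / 3)))).
      by rewrite ler_wpM2l // divr_ge0 ?mulr_ge0 ?sqr_ge0.
    rewrite (_ : _ * _ = N1 ^+ 2); last by field.
    by rewrite ler_peMl ?sqr_ge0 // ler1n.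
  rewrite (_ : c * _ = c * (k * (s1 * s2)) * (k * (s1 * s2))); last by ring.
  apply: ler_pM => //; rewrite ?mulr_ge0 //.
  have kss_ge0 : 0 <= k * (s1 * s2) by rewrite !mulr_ge0.
  rewrite -(ger0_norm kss_ge0) -sqrtr_sqr ler_wsqrtr //.
  rewrite (_ : (k * (s1 * s2)) ^+ 2 = s1 * (k * s1) * (s2 * (k * s2))); last by ring.
  by rewrite ler_pM ?mulr_ge0 // ler_wpM2l // lerDl.
rewrite ler_norml; apply/andP; split.
  by rewrite -[leLHS]sub0r lerB.
by apply: le_trans F_le; rewrite gerBl.
Qed.

End Count.
End EdgeSpectrum.
End GraphSpectrum.
End Tripartite.

(** * Cochains *)

Lemma sum_tupleS (M : nmodType) (T : finType) k (G : k.+1.-tuple T -> M) :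
  \sum_t G t = \sum_x \sum_(t : k.-tuple T) G [tuple of x :: t].
Proof.
rewrite pair_bigA /= (reindex (fun p : T * k.-tuple T => [tuple of p.1 :: p.2])) //=.
exists (fun t : k.+1.-tuple T => (thead t, [tuple of behead t])) => [[x t] _|t _] /=.
  by rewrite theadE; congr pair; apply: val_inj.
by rewrite -tuple_eta.
Qed.

Lemma sum_tuple0 (M : nmodType) (T : finType) (G : 0.-tuple T -> M) :
  \sum_t G t = G [tuple].
Proof. by rewrite (bigD1 [tuple]) //= big1 ?addr0 // => t; rewrite tuple0 => /eqP. Qed.

Lemma sum_tuple1 (M : nmodType) (T : finType) (G : 1.-tuple T -> M) :
  \sum_t G t = \sum_x G [tuple x].
Proof. by rewrite sum_tupleS; apply: eq_bigr => x _; rewrite sum_tuple0; congr G;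
  apply: val_inj. Qed.

Lemma sum_tuple2 (M : nmodType) (T : finType) (G : 2.-tuple T -> M) :
  \sum_t G t = \sum_x \sum_y G [tuple x; y].
Proof.
by rewrite sum_tupleS; apply: eq_bigr => x _; rewrite sum_tuple1; apply: eq_bigr => y _; congr G;
  apply: val_inj.
Qed.

Lemma sum_tuple3 (M : nmodType) (T : finType) (G : 3.-tuple T -> M) :
  \sum_t G t = \sum_x \sum_y \sum_z G [tuple x; y; z].
Proof.
rewrite sum_tupleS; apply: eq_bigr => x _; rewrite sum_tuple2.
by apply: eq_bigr => y _; apply: eq_bigr => z _; congr G; apply: val_inj.
Qed.

Lemma tuple1P (T : Type) (t : 1.-tuple T) : exists x, t = [tuple x].
Proof. by case: t => -[|x []] // i; exists x; apply: val_inj. Qed.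

Lemma tuple2P (T : Type) (t : 2.-tuple T) : exists x y, t = [tuple x; y].
Proof. by case: t => -[|x [|y []]] // i; exists x, y; apply: val_inj. Qed.

Lemma tuple3P (T : Type) (t : 3.-tuple T) : exists x y z, t = [tuple x; y; z].
Proof. by case: t => -[|x [|y [|z []]]] // i; exists x, y, z; apply: val_inj. Qed.

Section Cochains.
Variables (V : finType) (R : rcfType) (X : {set {set V}}).
Local Notation CC := (complex R).

Lemma permute_tupleM k (s s' : 'S_k) (t : k.-tuple V) :
  permute_tuple (s * s')%g t = permute_tuple s (permute_tuple s' t).
Proof. by apply: eq_from_tnth => j; rewrite !tnth_mktuple permM. Qed.

(** Transpositions generate the symmetric group and the sign is multiplicative. *)
Lemma skew_from_tperm k (f : k.-tuple V -> CC) :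
  (forall i j t, i != j -> f (permute_tuple (tperm i j) t) = - f t) ->
  forall (s : 'S_k) t, f (permute_tuple s t) = (-1) ^+ odd_perm s * f t.
Proof.
move=> fsk s; have [ts -> {s}] := prod_tpermP s.
elim: ts => [_ t|[i j] ts IH /= /andP[ij dts] t].
  rewrite big_nil odd_perm1 mul1r; congr f.
  by apply: eq_from_tnth => j; rewrite tnth_mktuple perm1.
rewrite big_cons permute_tupleM fsk // IH // odd_permM odd_tperm.
by rewrite /dpair /= in ij; rewrite ij signr_addb expr1 mulN1r mulNr.
Qed.

Lemma inner_full k (f g : cochain V R k) : in_Omega X g ->
  inner X f g = ((k.+1)`!%:R)^-1 * \sum_t f t * (g t)^*.
Proof.
move=> [_ g0]; rewrite /inner; congr (_ * _); rewrite big_mkcond; apply: eq_bigr => t _.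
by case: ifP => // /negbT /g0 ->; rewrite conjC0 mulr0.
Qed.

Lemma bd_full k (f : cochain V R k.+1) s : in_Omega X f ->
  bd X f s = \sum_v f [tuple of v :: s].
Proof.
move=> [_ f0]; rewrite /bd big_mkcond; apply: eq_bigr => v _.
by case: ifP => // /negbT /f0 ->.
Qed.

(** The difference of two adjoints at [f] pairs to zero with itself. This replaces [d1] and [d2],
    known only as adjoints, by the explicit [cob1] and [cob2]. *)
Lemma coboundary_unique k (d d' : cochain V R k -> cochain V R k.+1) f :
  is_coboundary X d -> is_coboundary X d' -> in_Omega X f -> forall t, d f t = d' f t.
Proof.
move=> [dO dA] [d'O d'A] Of.
have [ds d0] := dO _ Of; have [d's d'0] := d'O _ Of.
pose h : cochain V R k.+1 := fun t => d f t - d' f t.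
have Oh : in_Omega X h.
  split=> [s t|t nt]; first by rewrite /h ds d's mulrBr.
  by rewrite /h d0 // d'0 // subrr.
have hh : \sum_t h t * (h t)^* = 0.
  have /eqP : inner X h h = 0.
    have -> : inner X h h = inner X h (d f) - inner X h (d' f).
      rewrite !inner_full ?dO ?d'O // -mulrBr -sumrB; congr (_ * _).
      by apply: eq_bigr => t _; rewrite -mulrBr -rmorphB.
    by rewrite -dA // -d'A // subrr.
  rewrite inner_full // mulf_eq0 invr_eq0 pnatr_eq0 => /orP[|/eqP //].
  by rewrite eqn0Ngt fact_gt0.
move=> t; apply/eqP; rewrite -subr_eq0 -/(h t) -normr_eq0 -sqrf_eq0 normCK.
move/eqP: hh; rewrite psumr_eq0 => [/allP/(_ t (mem_index_enum _))//|u _].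
exact: mul_conjC_ge0.
Qed.

Lemma permute_tperm2 i j (x y : V) : i != j ->
  permute_tuple (tperm i j) [tuple x; y] = [tuple y; x].
Proof.
move=> ij; apply: eq_from_tnth => l; rewrite tnth_mktuple !(tnth_nth x) permE /=.
by move: i j l ij; do 3! case=> [[|[|?]] ?].
Qed.

Lemma permute_tperm3 i j (x y z : V) : i != j ->
  [\/ permute_tuple (tperm i j) [tuple x; y; z] = [tuple y; x; z],
      permute_tuple (tperm i j) [tuple x; y; z] = [tuple x; z; y]
    | permute_tuple (tperm i j) [tuple x; y; z] = [tuple z; y; x]].
Proof.
have tE l : tnth (permute_tuple (tperm i j) [tuple x; y; z]) l
    = nth x [:: x; y; z] (if l == i then j else if l == j then i else l).
  by rewrite tnth_mktuple !(tnth_nth x) permE /=.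
move=> ij; have [h|[h|h]] : (i + j == 1)%N \/ (i + j == 3)%N \/ (i + j == 2)%N.
- by clear tE; move: i j ij; do 2! (case=> [[|[|[|?]]] ?] //=); auto.
- apply: Or31; apply: eq_from_tnth => l; rewrite tE (tnth_nth x).
  by clear tE; move: i j l ij h; do 3! case=> [[|[|[|?]]] ?].
- apply: Or32; apply: eq_from_tnth => l; rewrite tE (tnth_nth x).
  by clear tE; move: i j l ij h; do 3! case=> [[|[|[|?]]] ?].
apply: Or33; apply: eq_from_tnth => l; rewrite tE (tnth_nth x).
by clear tE; move: i j l ij h; do 3! case=> [[|[|[|?]]] ?].
Qed.

Lemma in_Omega1P (f : cochain V R 1) :
  (forall x y, f [tuple y; x] = - f [tuple x; y]) ->
  (forall t, ~~ oriented_cell X t -> f t = 0) -> in_Omega X f.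
Proof.
move=> fs f0; split=> //; apply: skew_from_tperm => i j t ij.
by have [x [y ->]] := tuple2P t; rewrite permute_tperm2.
Qed.

Lemma in_Omega2P (f : cochain V R 2) :
  (forall x y z, f [tuple y; x; z] = - f [tuple x; y; z]) ->
  (forall x y z, f [tuple x; z; y] = - f [tuple x; y; z]) ->
  (forall t, ~~ oriented_cell X t -> f t = 0) -> in_Omega X f.
Proof.
move=> f12 f23 f0; split=> //; apply: skew_from_tperm => i j t ij.
have [x [y [z ->]]] := tuple3P t.
have [->|->|->] := @permute_tperm3 i j x y z ij; [exact: f12|exact: f23|].
by rewrite f12 f23 opprK f12.
Qed.

Lemma Omega1_skew (f : cochain V R 1) x y : in_Omega X f ->
  f [tuple y; x] = - f [tuple x; y].
Proof.
move=> [fs _]; rewrite -(@permute_tperm2 ord0 ord_max x y) // fs odd_tperm expr1 mulN1r //.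
Qed.

Lemma Omega2_skew12 (f : cochain V R 2) x y z : in_Omega X f ->
  f [tuple y; x; z] = - f [tuple x; y; z].
Proof.
move=> [fs _]; have := fs (tperm (@Ordinal 3 0 isT) (@Ordinal 3 1 isT)) [tuple x; y; z].
rewrite odd_tperm expr1 mulN1r => <-; congr f; apply: eq_from_tnth => l.
by rewrite tnth_mktuple !(tnth_nth x) permE; move: l; case=> [[|[|[|?]]] ?].
Qed.

Lemma Omega2_skew23 (f : cochain V R 2) x y z : in_Omega X f ->
  f [tuple x; z; y] = - f [tuple x; y; z].
Proof.
move=> [fs _]; have := fs (tperm (@Ordinal 3 1 isT) (@Ordinal 3 2 isT)) [tuple x; y; z].
rewrite odd_tperm expr1 mulN1r => <-; congr f; apply: eq_from_tnth => l.
by rewrite tnth_mktuple !(tnth_nth x) permE; move: l; case=> [[|[|[|?]]] ?].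
Qed.

Definition cob1 (g : cochain V R 0) : cochain V R 1 := fun t =>
  (oriented_cell X t)%:R * (g [tuple tnth t ord_max] - g [tuple tnth t ord0]).

Definition cob2 (g : cochain V R 1) : cochain V R 2 := fun t =>
  let x := tnth t (@Ordinal 3 0 isT) in let y := tnth t (@Ordinal 3 1 isT) in
  let z := tnth t (@Ordinal 3 2 isT) in
  (oriented_cell X t)%:R * (g [tuple y; z] - g [tuple x; z] + g [tuple x; y]).

Lemma cob1E g x y : cob1 g [tuple x; y] =
  (oriented_cell X [tuple x; y])%:R * (g [tuple y] - g [tuple x]).
Proof. by []. Qed.

Lemma cob2E g x y z : cob2 g [tuple x; y; z] =
  (oriented_cell X [tuple x; y; z])%:R * (g [tuple y; z] - g [tuple x; z] + g [tuple x; y]).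
Proof. by []. Qed.

Lemma oriented_cell_perm k (s t : k.-tuple V) : perm_eq s t ->
  oriented_cell X s = oriented_cell X t.
Proof.
move=> st; rewrite /oriented_cell (perm_uniq st); congr (_ && (_ \in X)).
by apply/setP => x; rewrite !inE (perm_mem st).
Qed.

Lemma cob1_coboundary : is_coboundary X cob1.
Proof.
have cob1O g : in_Omega X g -> in_Omega X (cob1 g).
  move=> _; apply: in_Omega1P => [x y|t nt]; last by rewrite /cob1 (negbTE nt) mul0r.
  rewrite !cob1E (@oriented_cell_perm _ [tuple y; x] [tuple x; y]);
    last by rewrite (perm_catC [:: y] [:: x]).
  by ring.
split=> // f g Of Og;
  rewrite (inner_full _ Og) (inner_full _ (cob1O _ Og)) (_ : 1`!%N = 1%N) // (_ : 2`!%N = 2%N) //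
    invr1 mul1r.
pose S := \sum_x \sum_y f [tuple x; y] * (g [tuple y])^*.
have e1 : \sum_t bd X f t * (g t)^* = S.
  rewrite sum_tuple1 /S exchange_big; apply: eq_bigr => y _; rewrite bd_full // mulr_suml.
  by apply: eq_bigr => x _; congr (f _ * _); apply: val_inj.
(* By skewness both orientations of an edge contribute alike, which makes up for [2!] against
   [1!]. *)
have e2 : \sum_t f t * (cob1 g t)^* = S + S.
  rewrite {2}/S exchange_big /S -big_split sum_tuple2; apply: eq_bigr => x _ /=.
  rewrite -big_split; apply: eq_bigr => y _ /=;
    rewrite cob1E (Omega1_skew x y Of) rmorphM rmorph_nat rmorphB.
  case: (boolP (oriented_cell X [tuple x; y])) => [_|nxy]; first by rewrite mul1r; ring.
  by have [_ f0] := Of; rewrite (f0 _ nxy); ring.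
rewrite e1 e2 -mulr2n -[S *+ 2]mulr_natl mulKf // pnatr_eq0 //.
Qed.

Lemma cob2_coboundary : is_coboundary X cob2.
Proof.
have cob2O g : in_Omega X g -> in_Omega X (cob2 g).
  move=> Og; apply: in_Omega2P => [x y z|x y z|t nt]; last by rewrite /cob2 (negbTE nt) mul0r.
    rewrite !cob2E (@oriented_cell_perm _ [tuple y; x; z] [tuple x; y; z]).
      by rewrite (Omega1_skew x y Og); ring.
    by rewrite /= -[[:: y, x & _]]/([:: y; x] ++ [:: z]) -[[:: x, y & _]]/([:: x;
      y] ++ [:: z]) perm_cat2r (perm_catC [:: y] [:: x]).
  rewrite !cob2E (@oriented_cell_perm _ [tuple x; z; y] [tuple x; y; z]).
    by rewrite (Omega1_skew y z Og); ring.
  by rewrite /= perm_cons (perm_catC [:: z] [:: y]).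
split=> // f g Of Og;
  rewrite (inner_full _ Og) (inner_full _ (cob2O _ Og)) (_ : 2`!%N = 2%N) // (_ : 3`!%N = 6%N) //.
pose G x y z := f [tuple x; y; z] * (g [tuple y; z])^*.
pose S := \sum_x \sum_y \sum_z G x y z.
have e1 : \sum_t bd X f t * (g t)^* = S.
  rewrite sum_tuple2 /S [RHS]exchange_big; apply: eq_bigr => y _ /=; rewrite [RHS]exchange_big.
  apply: eq_bigr => z _ /=; rewrite bd_full // mulr_suml.
  by apply: eq_bigr => x _; rewrite /G; congr (f _ * _); apply: val_inj.
(* Each of the three faces contributes [S], which makes up for [3!] against [2!]. *)
have e2 : \sum_t f t * (cob2 g t)^* = S + S + S.
  transitivity (S + \sum_x \sum_y \sum_z G y x z + \sum_x \sum_y \sum_z G z x y); last first.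
    by rewrite -sum3_swap12 (sum3_rot (fun x y z => G z x y)).
  rewrite sum_tuple3 /S -!big_split; apply: eq_bigr => x _ /=.
  rewrite -!big_split; apply: eq_bigr => y _ /=; rewrite -!big_split; apply: eq_bigr => z _ /=.
  rewrite cob2E /G (Omega2_skew12 x y z Of) (Omega2_skew12 x z y Of) (Omega2_skew23 x y z Of).
  rewrite rmorphM rmorph_nat rmorphD rmorphB.
  case: (boolP (oriented_cell X [tuple x; y; z])) => [_|nxyz]; first by rewrite mul1r; ring.
  by have [_ f0] := Of; rewrite (f0 _ nxyz); ring.
rewrite e1 e2 (_ : S + S + S = 3 * S); last by ring.
by field.
Qed.

End Cochains.

(** * From complexes to adjacency and triangle relations *)

Section ComplexFacts.
Variables (V : finType) (R : rcfType) (X : {set {set V}}) (part : V -> 'I_3) (k0 k1 : nat).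
Hypotheses (Xc : triangle_complex X) (Xp : tripartition X part).
Hypotheses (Xk0 : forall v : V, vertex_degree X v = k0)
  (Xk1 : forall e, e \in edges X -> edge_degree X e = k1).

(* [edges], [triangles] and [tripartition] compare cardinals with ring numerals of [nat]. *)
Lemma in_edges e : (e \in edges X) = (e \in X) && (#|e| == 2)%N.
Proof. by rewrite inE. Qed.

Lemma in_triangles t : (t \in triangles X) = (t \in X) && (#|t| == 3)%N.
Proof. by rewrite inE. Qed.

Lemma tripartition_card t i : t \in triangles X -> #|[set x in t | part x == i]| = 1%N.
Proof. by move=> h; rewrite Xp. Qed.

Definition cadj (x y : V) := [set x; y] \in edges X.
Definition ctri (x y z : V) := [set x; y; z] \in triangles X.

Lemma cadjC x y : cadj x y = cadj y x.
Proof. by rewrite /cadj setUC. Qed.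

Lemma ctri12 x y z : ctri x y z = ctri y x z.
Proof. by rewrite /ctri [[set x; y]]setUC. Qed.

Lemma ctri23 x y z : ctri x y z = ctri x z y.
Proof. by rewrite /ctri setUAC. Qed.

Lemma cadj_neq x y : cadj x y -> x != y.
Proof. by rewrite /cadj in_edges cards2 => /andP[_]; case: (x != y). Qed.

Lemma ctri_neq x y z : ctri x y z -> [/\ x != y, x != z & y != z].
Proof.
rewrite /ctri in_triangles [[set x; y; z]]setUC cardsU1 cards2 !inE negb_or => /andP[_].
by rewrite !(eq_sym z); case: (x != y); case: (x != z); case: (y != z).
Qed.

Lemma ctri_adj x y z : ctri x y z -> cadj x y.
Proof.
move=> h; have [xy _ _] := ctri_neq h; move: h;
  rewrite /ctri /cadj in_edges in_triangles cards2 xy eqxx andbT => /andP[tX _].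
case: Xc => _ down _ _ _; apply: down tX _ _; first exact: subsetUl.
by apply/set0Pn; exists x; rewrite !inE eqxx.
Qed.

Lemma ctri_part x y z : ctri x y z -> part x != part y.
Proof.
move=> h; have [xy _ _] := ctri_neq h; apply/negP => /eqP pxy.
suff : (#|[set x; y]| <= 1)%N by rewrite cards2 xy.
rewrite -(tripartition_card (part x) h); apply: subset_leq_card; apply/subsetP => v.
by rewrite !inE => /orP[]/eqP->; rewrite ?pxy !eqxx ?orbT.
Qed.

Lemma cadj_deg x : \sum_y (cadj x y)%:R = k0%:R :> R.
Proof.
rewrite -natr_sum -(Xk0 x) /vertex_degree; congr _%:R.
have -> : [set e in edges X | x \in e] = [set [set x; y] | y in [set y | cadj x y]].
  apply/setP => e; apply/idP/imsetP => [|[y]]; rewrite !inE; last first.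
    by move=> yx ->; rewrite -in_edges -/(cadj x y) yx !inE eqxx.
  move=> /andP[/andP[eX /cards2P[u [v [uv ee]]]]]; rewrite ee !inE => /orP[]/eqP xe; subst x.
    by exists v; rewrite // inE /cadj in_edges -ee eX ee cards2 uv.
  by exists u; [rewrite inE /cadj in_edges setUC -ee eX ee cards2 uv|rewrite setUC].
rewrite card_in_imset => [|y z].
  by rewrite -sum1_card [RHS]big_mkcond; apply: eq_bigr => y _; rewrite inE; case: (cadj x y).
rewrite !inE => /cadj_neq xy /cadj_neq xz /setP/(_ y); rewrite !inE eqxx orbT.
by rewrite eq_sym (negbTE xy) /= => /esym/eqP.
Qed.

Lemma ctri_deg x y : \sum_z (ctri x y z)%:R = k1%:R * (cadj x y)%:R :> R.
Proof.
case: (boolP (cadj x y)) => [xy|nxy]; last first.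
  rewrite mulr0 big1 // => z _; case: (boolP (ctri x y z)) => // /ctri_adj.
  by rewrite (negbTE nxy).
rewrite mulr1 -natr_sum -(Xk1 xy) /edge_degree; congr _%:R.
have -> : [set t in triangles X | [set x; y] \subset t]
    = [set [set x; y; z] | z in [set z | ctri x y z]].
  apply/setP => e; apply/idP/imsetP => [|[z]]; rewrite !inE; last first.
    by move=> tz ->; rewrite -in_triangles -/(ctri x y z) tz subsetUl.
  move=> /andP[/andP[eX e3] xye].
  have /cards1P [z ez] : #|e :\: [set x; y]| == 1%N.
    by rewrite cardsD (setIidPr xye) (eqP e3) cards2 (cadj_neq xy).
  have ee : e = [set x; y;
    z] by rewrite -ez setUC setDE setUIl (setUidPl xye) [X in _ :&: X]setUC setUCr setIT.
  by exists z => //; rewrite inE /ctri in_triangles -ee eX.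
rewrite card_in_imset => [|z w].
  by rewrite -sum1_card [RHS]big_mkcond; apply: eq_bigr => z _; rewrite inE; case: (ctri x y z).
rewrite !inE => /ctri_neq[_ xz yz] _ /setP/(_ z); rewrite !inE eqxx !orbT.
by rewrite ![z == _]eq_sym (negbTE xz) (negbTE yz) /= => /esym/eqP.
Qed.

Lemma complex_nontrivial : exists x y z, ctri x y z.
Proof.
case: Xc => _ _ _ _ [t /andP[tX /eqP t3]].
have /card_gt0P[x xt] : (0 < #|t|)%N by rewrite t3.
have t2 : #|t :\ x| = 2 by apply/eqP;
  rewrite -(eqn_add2l 1) -[X in (X + _)%N]/(true : nat) -xt -cardsD1 t3.
have /cards2P[y [z [yz tyz]]] := introT eqP t2.
exists x, y, z; rewrite /ctri in_triangles -setUA -tyz setD1K // tX t3 //.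
Qed.

Lemma k1_gt0 : (0 < k1)%N.
Proof.
have [x [y [z xyz]]] := complex_nontrivial; have xy := ctri_adj xyz.
rewrite -(Xk1 xy) card_gt0; apply/set0Pn; exists [set x; y; z].
by rewrite inE subsetUl andbT.
Qed.

Lemma k0_gt0 : (0 < k0)%N.
Proof.
have [x [y [z xyz]]] := complex_nontrivial; have xy := ctri_adj xyz.
rewrite -(Xk0 x) card_gt0; apply/set0Pn; exists [set x; y].
by rewrite inE !in_set2 eqxx andbT.
Qed.

Lemma cell1 x : oriented_cell X [tuple x].
Proof.
rewrite /oriented_cell /=; case: Xc => _ _ _ hv _.
suff -> : [set u in [tuple x]] = [set x] by exact: hv.
by apply/setP => u; rewrite !inE.
Qed.

Lemma cell2 x y : oriented_cell X [tuple x; y] = cadj x y.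
Proof.
rewrite /oriented_cell /cadj in_edges cards2 /= inE andbT andbC.
suff -> : [set u in [tuple x; y]] = [set x; y] by case: (x == y); rewrite ?andbF ?andbT.
by apply/setP => u; rewrite !inE.
Qed.

Lemma cell3 x y z : oriented_cell X [tuple x; y; z] = ctri x y z.
Proof.
rewrite /oriented_cell /ctri in_triangles andbC.
suff -> : [set u in [tuple x; y; z]] = [set x; y; z].
  congr (_ && _); rewrite [[set x; y; z]]setUC cardsU1 cards2 /= !inE negb_or !(eq_sym z) andbT.
  by case: (x == y); case: (x == z); case: (y == z).
by apply/setP => u; rewrite !inE orbA.
Qed.

(** Read as a complex cochain, an eigenvector of [Adj] for [x] is one of [Delta_0^+] for
    [k0 - x]. *)
Lemma real_spec0 d1 (mu0 : R) : is_coboundary X d1 ->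
  (forall lam, spec_up0 X d1 lam ->
     exists x : R, lam = real_complex R x /\
       (in_interval x (k0%:R - mu0) (k0%:R + mu0) \/ x = 3%:R * k0%:R / 2%:R)) ->
  forall (phi : {ffun V -> R^o}) x, Z0 phi -> phi != 0 ->
    Adj cadj phi = x *: phi -> `|x| <= mu0 \/ x = - (k0%:R / 2).
Proof.
move=> cob spec phi x Zphi phi0 Aphi.
pose f : cochain V R 0 := fun t => real_complex R (phi (thead t)).
have fE v : f [tuple v] = real_complex R (phi v) by rewrite /f theadE.
have Of : in_Omega X f.
  split=> [s t|t]; last by have [v ->] := tuple1P t; rewrite cell1.
  have [v ->] := tuple1P t; have -> : s = 1%g.
    by apply/permP => i; rewrite perm1 !ord1.
  rewrite odd_perm1 mul1r; congr f.
  by apply: eq_from_tnth => j; rewrite tnth_mktuple perm1.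
have [|x' [e h]] := spec (real_complex R (k0%:R - x)).
  exists f; split=> //.
  - rewrite /bd0 big_mkcond; under eq_bigr do rewrite cell1 fE.
    by rewrite -rmorph_sum Zphi rmorph0.
  - have /existsP[v hv] : [exists v, phi v != 0].
      apply: contraR phi0; rewrite negb_exists => /forallP h; apply/eqP/ffunP => v.
      by rewrite ffunE; apply/eqP; move: (h v); rewrite negbK.
    exists [tuple v]; rewrite fE; apply: contraNneq hv => h.
    by apply/eqP; apply: (@complexI R); rewrite h rmorph0.
  move=> t; have [v ->] := tuple1P t; rewrite fE -rmorphM.
  transitivity (\sum_u cob1 X f [tuple u; v]).
    have [O1 _] := cob; rewrite bd_full; last exact: O1.
    apply: eq_bigr => u _; rewrite (coboundary_unique cob (cob1_coboundary R X) Of).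
    by congr (cob1 X f _); apply: val_inj.
  transitivity (real_complex R (\sum_u (cadj v u)%:R * (phi v - phi u))).
    rewrite rmorph_sum; apply: eq_bigr => u _; rewrite cob1E !fE cell2 (cadjC u v).
    by rewrite rmorphM rmorphB rmorph_nat.
  congr (real_complex R _); under eq_bigr do rewrite mulrBr; rewrite sumrB -AdjE Aphi ffZE.
  by rewrite -mulr_suml cadj_deg mulrBl.
move/complexI: e => e; case: h => [/andP[h1 h2]|h]; [left|right].
  by rewrite ler_norml; apply/andP; split; lra.
by move: e; rewrite h; lra.
Qed.

(** As every edge lies in [k1] triangles, [Delta_1^+] is [k1 - T1] on skew forms, so [x] corresponds
    to [k1 - x]. *)
Lemma real_spec1 d2 (mu1 : R) : is_coboundary X d2 ->
  (forall lam, spec_up1 X d2 lam ->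
     exists x : R, lam = real_complex R x /\
       [\/ in_interval x (k1%:R - mu1) (k1%:R + mu1),
           in_interval x (2%:R * k1%:R - mu1) (2%:R * k1%:R + mu1)
         | x = 3%:R * k1%:R]) ->
  forall (f : {ffun V * V -> R^o}) x, Z1 cadj f -> f != 0 -> T1 ctri f = x *: f ->
    [\/ `|x| <= mu1, `|x + k1%:R| <= mu1 | x = - (2 * k1%:R)].
Proof.
move=> cob spec f x [[fs fa] bf] f0 Tf.
pose g : cochain V R 1 := fun t => real_complex R (f (tnth t ord0, tnth t ord_max)).
have gE u v : g [tuple u; v] = real_complex R (f (u, v)) by [].
have Og : in_Omega X g.
  apply: in_Omega1P => [u v|t]; first by rewrite !gE fs rmorphN.
  have [u [v ->]] := tuple2P t; rewrite cell2 gE -fa => /negbTE ->.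
  by rewrite mul0r rmorph0.
have [|x' [e h]] := spec (real_complex R (k1%:R - x)).
  exists g; split=> //.
  - move=> t; have [v ->] := tuple1P t; rewrite bd_full //.
    transitivity (\sum_u g [tuple u; v]).
      by apply: eq_bigr => u _; congr g; apply: val_inj.
    under eq_bigr do rewrite gE; rewrite -rmorph_sum.
    by have /ffunP/(_ v) := bf; rewrite !ffunE => ->; rewrite rmorph0.
  - have /existsP[[u v] hv] : [exists p, f p != 0].
      apply: contraR f0; rewrite negb_exists => /forallP h; apply/eqP/ffunP => v.
      by rewrite ffunE; apply/eqP; move: (h v); rewrite negbK.
    exists [tuple u; v]; rewrite gE; apply: contraNneq hv => h.
    by apply/eqP; apply: (@complexI R); rewrite h rmorph0.
  move=> t; have [u [v ->]] := tuple2P t; rewrite gE -rmorphM.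
  transitivity (\sum_w cob2 X g [tuple w; u; v]).
    have [O1 _] := cob; rewrite bd_full; last exact: O1.
    apply: eq_bigr => w _; rewrite (coboundary_unique cob (cob2_coboundary R X) Og).
    by congr (cob2 X g _); apply: val_inj.
  transitivity (real_complex R (\sum_w (ctri u v w)%:R * (f (u, v) - (f (u, w) + f (w, v))))).
    rewrite rmorph_sum; apply: eq_bigr => w _; rewrite cob2E !gE cell3.
    have -> : ctri w u v = ctri u v w by rewrite ctri12 ctri23.
    rewrite rmorphM rmorphB rmorph_nat rmorphD (fs w u) rmorphN; congr (_ * _).
    by ring.
  congr (real_complex R _); under eq_bigr do rewrite mulrBr; rewrite sumrB -T1E Tf ffZE.
  by rewrite -mulr_suml ctri_deg mulrBl -mulrA fa.
move/complexI: e => e; case: h => [/andP[h1 h2]|/andP[h1 h2]|h].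
- by apply: Or31; rewrite ler_norml; apply/andP; split; lra.
- by apply: Or32; rewrite ler_norml; apply/andP; split; lra.
by apply: Or33; move: e; rewrite h; lra.
Qed.

(** * Pairs of triangles as quadruples of vertices *)

Lemma three_sets_triangle (S1 S2 S3 : {set V}) t :
  [disjoint S1 & S2] -> [disjoint S1 & S3] -> [disjoint S2 & S3] ->
  t \in triangles X -> #|t :&: S1| = 1%N -> #|t :&: S2| = 1%N -> #|t :&: S3| = 1%N ->
  exists x y z, [/\ x \in S1, y \in S2, z \in S3 & t = [set x; y; z]].
Proof.
move=> d12 d13 d23; rewrite in_triangles => /andP[_ /eqP t3].
move=> /eqP/cards1P[x ex] /eqP/cards1P[y ey] /eqP/cards1P[z ez].
have /setIP[xt x1] : x \in t :&: S1 by rewrite ex inE.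
have /setIP[yt y2] : y \in t :&: S2 by rewrite ey inE.
have /setIP[zt z3] : z \in t :&: S3 by rewrite ez inE.
have xy : x != y by apply: contraTneq x1 => ->; rewrite (disjointFl d12 y2).
have xz : x != z by apply: contraTneq x1 => ->; rewrite (disjointFl d13 z3).
have yz : y != z by apply: contraTneq y2 => ->; rewrite (disjointFl d23 z3).
exists x, y, z; split=> //; apply/esym/eqP; rewrite eqEcard t3; apply/andP; split.
  by apply/subsetP => u; rewrite !inE => /orP[/orP[]|]/eqP->.
by rewrite [[set x; y; z]]setUC cardsU1 cards2 xy !inE negb_or !(eq_sym z) xz yz.
Qed.

Lemma three_sets_inter (S1 S2 S3 : {set V}) x y z : [disjoint S1 & S2] -> [disjoint S1 & S3] ->
  x \in S1 -> y \in S2 -> z \in S3 -> [set x; y; z] :&: S1 = [set x].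
Proof.
move=> d12 d13 x1 y2 z3; apply/setP => u; rewrite !inE.
have [->|ux] := eqVneq u x; first by rewrite x1.
have [->|uy] := eqVneq u y; first by rewrite (disjointFl d12 y2).
by have [->|uz] := eqVneq u z; rewrite // (disjointFl d13 z3).
Qed.

(** A pair corresponds to its shared edge together with the two opposite vertices. The vertex in [A]
    is outside [B], [C] and [D], hence outside the second triangle, so the shared edge must join [B]
    and [C]. *)
Lemma card_F2 (A B C D : {set V}) :
  [disjoint A & B] -> [disjoint A & C] -> [disjoint A & D] ->
  [disjoint B & C] -> [disjoint B & D] -> [disjoint C & D] ->
  #|F2 X A B C D|%:R = two_triangles R ctri A B C D.
Proof.
move=> dAB dAC dAD dBC dBD dCD.
have ds (S T : {set V}) : [disjoint S & T] -> [disjoint T & S] by rewrite disjoint_sym.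
pose Q : {set (V * V) * (V * V)} := [set q | [&& q.1.1 \in B, q.1.2 \in C, q.2.1 \in A,
  q.2.2 \in D, ctri q.1.1 q.1.2 q.2.1 & ctri q.1.1 q.1.2 q.2.2]].
pose h (q : (V * V) * (V * V)) := ([set q.1.1; q.1.2; q.2.1], [set q.1.1; q.1.2; q.2.2]).
have interBCA y z x : y \in B -> z \in C -> x \in A ->
   [/\ [set y; z; x] :&: A = [set x], [set y; z; x] :&: B = [set y] & [set y; z;
     x] :&: C = [set z]].
  move=> yB zC xA; split.
  - by rewrite setUC setUA; apply: three_sets_inter dAB dAC xA yB zC.
  - by apply: three_sets_inter dBC (ds _ _ dAB) yB zC xA.
  by rewrite [[set y; z]]setUC; apply: three_sets_inter (ds _ _ dBC) (ds _ _ dAC) zC yB xA.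
have interBCD y z x : y \in B -> z \in C -> x \in D ->
   [/\ [set y; z; x] :&: B = [set y], [set y; z; x] :&: C = [set z] & [set y; z;
     x] :&: D = [set x]].
  move=> yB zC xD; split.
  - by apply: three_sets_inter dBC dBD yB zC xD.
  - by rewrite [[set y; z]]setUC; apply: three_sets_inter (ds _ _ dBC) dCD zC yB xD.
  by rewrite setUC setUA; apply: three_sets_inter (ds _ _ dBD) (ds _ _ dCD) xD yB zC.
have -> : F2 X A B C D = h @: Q.
  apply/setP => -[p1 p2]; apply/idP/imsetP.
    rewrite inE /= => /and5P[t1 t2 /eqP p1A /eqP p1B] /and5P[/eqP p1C /eqP p2B /eqP p2C /eqP p2D
      /eqP p12].
    have [y [z [x [yB zC xA e1]]]] := three_sets_triangle dBC (ds _ _ dAB) (ds _ _ dAC) t1 p1B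
      p1C p1A.
    have [y' [z' [w [y'B z'C wD e2]]]] := three_sets_triangle dBC dBD dCD t2 p2B p2C p2D.
    have [i1A i1B i1C] := interBCA _ _ _ yB zC xA.
    have [i2B i2C i2D] := interBCD _ _ _ y'B z'C wD.
    have sub : p1 :&: p2 \subset [set y; z].
      apply/subsetP => u; rewrite e1 e2 !inE => /andP[/orP[->//|/eqP->]].
      move=> /orP[/orP[]|]/eqP xe; move: xA; rewrite xe.
      - by rewrite (disjointFl dAB y'B).
      - by rewrite (disjointFl dAC z'C).
      by rewrite (disjointFl dAD wD).
    have eqyz : p1 :&: p2 = [set y; z].
      by apply/eqP; rewrite eqEcard sub p12 cards2; case: (y != z).
    have yp2 : y \in p2 by have : y \in p1 :&: p2; [rewrite eqyz !inE eqxx|rewrite inE => /andP[]].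
    have zp2 : z \in p2 by have : z \in p1 :&: p2;
      [rewrite eqyz !inE eqxx orbT|rewrite inE => /andP[]].
    have yy : y = y' by apply/set1P; rewrite -i2B -e2 inE yp2.
    have zz : z = z' by apply/set1P; rewrite -i2C -e2 inE zp2.
    subst y' z'; exists ((y, z), (x, w)); last by rewrite /h /= -e1 -e2.
    by rewrite inE /= yB zC xA wD /ctri -e1 -e2 t1 t2.
  move=> [[[y z] [x w]]]; rewrite inE /= => /and5P[yB zC xA wD /andP[t1 t2]] [-> ->].
  have [i1A i1B i1C] := interBCA _ _ _ yB zC xA.
  have [i2B i2C i2D] := interBCD _ _ _ yB zC wD.
  rewrite inE /= i1A i1B i1C i2B i2C i2D !cards1 -/(ctri y z x) -/(ctri y z w) t1 t2 /=.
  have -> : [set y; z; x] :&: [set y; z; w] = [set y; z].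
    apply/setP => u; rewrite !inE; case: (u == y) => //=; case: (u == z) => //=.
    by apply/negP => /andP[/eqP-> /eqP xw]; rewrite xw (disjointFl dAD wD) in xA.
  have yz : y != z by apply: contraTneq yB => ->; rewrite (disjointFl dBC zC).
  by rewrite cards2 yz.
rewrite card_in_imset => [|[[y z] [x w]] [[y' z'] [x' w']]]; last first.
  rewrite !inE /= => /and5P[yB zC xA wD _] /and5P[y'B z'C x'A w'D _] [e1 e2].
  have [i1A i1B i1C] := interBCA _ _ _ yB zC xA.
  have [i1A' i1B' i1C'] := interBCA _ _ _ y'B z'C x'A.
  have [_ _ i2D] := interBCD _ _ _ yB zC wD.
  have [_ _ i2D'] := interBCD _ _ _ y'B z'C w'D.
  have -> : y = y' by apply: set1_inj; rewrite -i1B e1 i1B'.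
  have -> : z = z' by apply: set1_inj; rewrite -i1C e1 i1C'.
  have -> : x = x' by apply: set1_inj; rewrite -i1A e1 i1A'.
  by have -> : w = w' by apply: set1_inj; rewrite -i2D e2 i2D'.
have sum_pair (S T : finType) (G : S * T -> R) : \sum_p G p = \sum_y \sum_z G (y, z).
  by rewrite pair_bigA; apply: eq_bigr => -[].
rewrite -sum1_card natr_sum big_mkcond /= !sum_pair.
apply: eq_bigr => y _; apply: eq_bigr => z _; rewrite sum_pair.
rewrite /link mulr_suml mulr_sumr; apply: eq_bigr => x _; rewrite !mulr_sumr; apply: eq_bigr => w _.
rewrite inE /=; case: (y \in B); case: (z \in C); case: (x \in A); case: (w \in D);
  case: (ctri y z x); case: (ctri y z w); rewrite /= ?(mulr0, mul0r, mulr1) //.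
Qed.

End ComplexFacts.

Theorem theorem7p1 (V : finType) (R : rcfType) (X : {set {set V}})
    (part : V -> 'I_3) (k0 k1 : nat) (mu0 mu1 : R)
    (d1 : cochain V R 0 -> cochain V R 1) (d2 : cochain V R 1 -> cochain V R 2)
    (A B C D : {set V}) :
  triangle_complex X ->
  tripartition X part ->
  (forall v : V, vertex_degree X v = k0) ->
  (forall e, e \in edges X -> edge_degree X e = k1) ->
  0 <= mu0 -> 0 <= mu1 ->
  is_coboundary X d1 -> is_coboundary X d2 ->
  (forall lam, spec_up0 X d1 lam ->
     exists x : R, lam = real_complex R x /\
       (in_interval x (k0%:R - mu0) (k0%:R + mu0) \/ x = 3%:R * k0%:R / 2%:R)) ->
  (forall lam, spec_up1 X d2 lam ->
     exists x : R, lam = real_complex R x /\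
       [\/ in_interval x (k1%:R - mu1) (k1%:R + mu1),
           in_interval x (2%:R * k1%:R - mu1) (2%:R * k1%:R + mu1)
         | x = 3%:R * k1%:R]) ->
  [disjoint A & B] -> [disjoint A & C] -> [disjoint A & D] ->
  [disjoint B & C] -> [disjoint B & D] -> [disjoint C & D] ->
  (exists i j l : 'I_3, [/\ [&& i != j, i != l & j != l],
     {subset A :|: D <= [pred x | part x == i]},
     {subset B <= [pred x | part x == j]} &
     {subset C <= [pred x | part x == l]}]) ->
  let n : R := #|V|%:R in
  let a : R := #|A|%:R in let b : R := #|B|%:R in
  let c : R := #|C|%:R in let d : R := #|D|%:R in
  let K0 : R := k0%:R in let K1 : R := k1%:R in
  `| #|F2 X A B C D|%:R - 27%:R * K0 * K1 ^+ 2 * a * b * c * d / (2%:R * n ^+ 3) |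
  <= 6%:R * mu0 * K1 ^+ 2 * Num.sqrt (a * b * c * d) / (K0 * n)
       * (3%:R * K0 * (Num.sqrt (a * b) + Num.sqrt (c * d)) / (2%:R * n) + mu0)
     + (2%:R * K1 ^+ 2 * mu0 / K0 + (K1 + mu1) * mu1)
       * Num.sqrt (Num.sqrt (a * b * c * d))
       * Num.sqrt ((3%:R * K0 * Num.sqrt (a * b) / (2%:R * n) + mu0)
                   * (3%:R * K0 * Num.sqrt (c * d) / (2%:R * n) + mu0)).
Proof.
move=> Xc Xp Xk0 Xk1 mu0_ge0 mu1_ge0 cob1 cob2 sp0 sp1 dAB dAC dAD dBC dBD dCD.
move=> [i [j [l [/and3P[ij il jl] ADi Bj Cl]]]]; cbv zeta.
rewrite (card_F2 R X dAB dAC dAD dBC dBD dCD).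
(* The blocks are renumbered so that [A] and [D] lie in block [0], [B] in block [1] and [C] in block
   [2]. *)
pose part' v : 'I_3 := if part v == i then @Ordinal 3 0 isT
  else if part v == j then @Ordinal 3 1 isT else @Ordinal 3 2 isT.
have part'_neq x y z : ctri X x y z -> part' x != part' y.
  move=> /(ctri_part Xp); rewrite /part'.
  have part3 v : [|| part v == i, part v == j | part v == l].
    case: eqVneq => //= vi; case: eqVneq => //= vj; apply/eqP.
    by apply: (@ord3_third i j).
  case/or3P: (part3 x) => /eqP->; case/or3P: (part3 y) => /eqP->;
    by rewrite ?eqxx ?(eq_sym j i) ?(eq_sym l i) ?(eq_sym l j)
      ?(negbTE ij) ?(negbTE il) ?(negbTE jl) ?eqxx.
have V_gt0 : (0 < #|V|)%N.
  by have [x _] := complex_nontrivial Xc; apply/card_gt0P; exists x.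
apply: (@tripartite_mixing R V (cadj X) (ctri X) part' k0%:R k1%:R V_gt0) => //.
- by rewrite ltr0n (k0_gt0 Xc Xk0).
- by rewrite ltr0n (k1_gt0 Xc Xk1).
- exact: cadjC.
- exact: ctri12.
- exact: ctri23.
- exact: cadj_deg.
- exact: ctri_deg.
- exact: real_spec0 cob1 sp0.
- exact: real_spec1 cob2 sp1.
- move=> x xA; rewrite /part'.
  by have /ADi/eqP-> : x \in A :|: D; rewrite ?inE ?xA // eqxx.
- by move=> x xB; rewrite /part'; have /eqP-> := Bj _ xB; rewrite eq_sym (negbTE ij) eqxx.
- move=> x xC; rewrite /part'; have /eqP-> := Cl _ xC.
  by rewrite !(eq_sym l) (negbTE il) (negbTE jl).
move=> x xD; rewrite /part'.
by have /ADi/eqP-> : x \in A :|: D; rewrite ?inE ?xD ?orbT // eqxx.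
Qed.
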